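(* The symmetric convexified Tsirelson space $S(T^2)$ fails property upper $(H)$, even for disjointly supported elements (that is, there is no constant $M$ such that $\|\sum_{i=1}^n x_i\|\le M\sqrt n$ for every $n$ and all normalized disjointly supported $x_1,\dots,x_n\in S(T^2)$), and it fails property lower $(H_2)$. Hence $S(T^2)$ is not of weak type 2 and not of cotype 2.
   Context: Scalars are real. Property upper $(H)$: a Banach space $X$ has property upper $(H)$ if there is a function $f(\cdot)$ such that every normalized $\lambda$-unconditional basic sequence $(x_i)_{i=1}^n$ in $X$ satisfies $\|\sum_{i=1}^n x_i\|\le f(\lambda)n^{1/2}$. Property lower $(H_2)$: a Banach space $X$ has property lower $(H_2)$ if there is a function $C(\cdot,\cdot)$ such that for every $0<\delta<1$ and every normalized $\lambda$-unconditional basic sequence $(x_i)_{i=1}^n$ in $X$ there is a subset $F\subseteq\{1,\dots,n\}$ with $|F|\ge\delta n$ such that the unit vector basis of $\ell_2^{|F|}$ is $C(\lambda,\delta)$-dominated by $(x_i)_{i\in F}$, i.e. $(\sum_{i\in F}|a_i|^2)^{1/2}\le C(\lambda,\delta)\|\sum_{i\in F}a_ix_i\|$ for all scalars $(a_i)$. Weak type 2: a Banach space $X$ is of weak type 2 if there are a constant $C$ and a $\delta$, $0<\delta<1$, such that whenever $E\subseteq X$ is a subspace, $n\in\mathbb N$ and $T:E\to\ell_2^n$ is a bounded linear operator, there are an orthogonal projection $P$ on $\ell_2^n$ of rank larger than $\delta n$ and a bounded linear operator $S:X\to\ell_2^n$ with $Sx=PTx$ for all $x\in E$ and $\|S\|\le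 C\|T\|$. Cotype 2: with $(g_j)$ independent standard Gaussian variables on a probability space $(\Omega,\mathcal S,\mu)$, $X$ is of cotype 2 if there is a constant $K$ such that $(\sum_{j=1}^n\|x_j\|^2)^{1/2}\le K\big(\int\|\sum_{j=1}^n g_j(t)x_j\|^2d\mu(t)\big)^{1/2}$ for all finite sets $\{x_1,\dots,x_n\}\subseteq X$. The convexified Tsirelson space $T^2$: for finite nonempty sets $E,F\subseteq\mathbb N=\{1,2,\dots\}$ write $E<F$ if every element of $E$ is smaller than every element of $F$, and $k\le E$ if $k\le \min E$. For a scalar sequence $x=(a_n)$ let $Ex$ denote the sequence which agrees with $x$ on $E$ and is $0$ off $E$. $T^2$ is the Banach space of all sequences $x=(a_n)$, written $x=\sum_n a_nt_n$ with $(t_n)$ the unit vectors, for which the following recursively defined norm is finite: $$\|x\|_{T^2}=\max\Big\{\sup_n|a_n|,\ 2^{-1/2}\sup\Big(\sum_{j=1}^k\|E_jx\|_{T^2}^2\Big)^{1/2}\Big\},$$ where the second supremum is over all $k\ge1$ and all $k\le E_1<E_2<\cdots<E_k$. (Explicitly, $\|x\|_{T^2}=\lim_m\|x\|_m$, where $\|x\|_0=\sup_n|a_n|$ and $\|x\|_{m+1}=\max\{\|x\|_0,\,2^{-1/2}\sup(\sum_{j=1}^k\|E_jx\|_m^2)^{1/2}\}$.) The unit vectors form a 1-unconditional basis of $T^2$. The rearrangement operator $D$: for a scalar sequence $x=(a_n)$ tending to $0$, $Dx=\sum_n a_n^*t_n$, where $(a_n^* )$ is the rearrangement of the nonzero $a_n$'s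 with non-increasing absolute values (followed by zeros if only finitely many $a_n$ are nonzero). The symmetric convexified Tsirelson space $S(T^2)$: the space of all sequences $x$ tending to $0$ with $\|Dx\|_{T^2}<\infty$, equipped with a norm $\|\cdot\|_s$ for which there is $K\ge1$ with $\frac1K\|x\|_s\le\|Dx\|_{T^2}\le K\|x\|_s$ for all such $x$. Such a norm exists, and with it $S(T^2)$ is a Banach space determined up to isomorphism. *)

(* Defs.v *)
From HB Require Import structures.
From mathcomp Require Import all_boot all_order all_algebra finmap.
From mathcomp Require Import all_classical all_reals all_analysis.
Import Order.TTheory GRing.Theory Num.Theory.
Import numFieldNormedType.Exports.
Set Implicit Arguments.
Unset Strict Implicit.
Unset Printing Implicit Defensive.
Local Open Scope classical_set_scope.
Local Open Scope ring_scope.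

(* Scalar sequences (a_1, a_2, ...) are functions nat -> R whose value at n is
   the coefficient a_(n+1) of the unit vector t_(n+1); the 1-based position of
   the index n is therefore n.+1. *)

Definition fset_before (E F : {fset nat}) : bool := allrel ltn E F.

(* k <= E, in terms of 1-based positions *)
Definition starts_from (k : nat) (E : {fset nat}) : bool :=
  all (fun n => (k <= n.+1)%N) E.

(* Es = [:: E_1; ...; E_k] with k >= 1 and k <= E_1 < ... < E_k *)
Definition admissible (Es : seq {fset nat}) : bool :=
  [&& (0 < size Es)%N, all (fun E => E != fset0) Es,
      starts_from (size Es) (head fset0 Es) & sorted fset_before Es].

Section Tsirelson.
Context {R : realType}.
Implicit Types x y : nat -> R.

Definition fset_restrict (E : {fset nat}) x : nat -> R :=
  fun n => if n \in E then x n else 0.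

Definition sup_norm x : \bar R := ereal_sup [set `|x n|%:E | n in [set: nat]].

Fixpoint T2norm_stage (m : nat) x : \bar R :=
  if m is m'.+1 then
    maxe (sup_norm x)
      (((Num.sqrt 2)^-1)%:E *
       ereal_sup [set sqrte (\sum_(E <- Es)
                              T2norm_stage m' (fset_restrict E x) ^+ 2)
                 | Es in [set Es : seq {fset nat} | admissible Es]])%E
  else sup_norm x.

(* The stages are nondecreasing in m, so the limit exists in \bar R; it is +oo
   exactly when x is not in T^2. *)
Definition T2norm x : \bar R := limn (fun m => T2norm_stage m x).

(* y lists the nonzero terms of x by non-increasing absolute value, followed by
   zeros if x has only finitely many nonzero terms. *)
Definition is_rearrangement x y : Prop :=
  (forall n, `|y n.+1| <= `|y n|) /\
  exists2 p : nat -> nat,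
    set_bij [set n | y n != 0] [set n | x n != 0] p &
    forall n, y n != 0 -> y n = x (p n).

(* Ties between equal absolute values are broken arbitrarily; `|Drearr x n|, hence
   T2norm (Drearr x), does not depend on how.  A rearrangement exists whenever x
   tends to 0, and only such x are used. *)
Definition Drearr x : nat -> R := xget (fun=> 0) [set y | is_rearrangement x y].

Definition symT2 : set (nat -> R) :=
  [set x | x n @[n --> \oo] --> (0 : R) /\ (T2norm (Drearr x) < +oo)%E].

End Tsirelson.

(* X is the space S(T^2), coef v being the sequence that the vector v : X is.
   S(T^2) carries no preferred norm: any norm equivalent to T2norm \o Drearr will
   do. *)
Definition is_symmetric_T2 (R : realType) (X : completeNormedModType R)
    (coef : X -> nat -> R) : Prop :=
  [/\ forall (a : R) (u v : X) n, coef (a *: u + v) n = a * coef u n + coef v n,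
      injective coef,
      range coef = symT2 &
      exists2 K : R, 1 <= K & forall v : X,
        ((K^-1 * `|v|)%:E <= T2norm (Drearr (coef v)))%E /\
        (T2norm (Drearr (coef v)) <= (K * `|v|)%:E)%E].

Section Banach_properties.
Context {R : realType}.
Implicit Type X : normedModType R.

Definition normalized X n (x : 'I_n -> X) : Prop := forall i, `|x i| = 1.

Definition linearly_independent X n (x : 'I_n -> X) : Prop :=
  forall a : 'I_n -> R, \sum_i a i *: x i = 0 -> forall i, a i = 0.

Definition unconditional_basic X (lambda : R) n (x : 'I_n -> X) : Prop :=
  linearly_independent x /\
  forall (a : 'I_n -> R) (e : 'I_n -> bool),
    `|\sum_i ((-1) ^+ e i * a i) *: x i| <= lambda * `|\sum_i a i *: x i|.

Definition upper_H X : Prop :=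
  exists f : R -> R, forall (lambda : R) n (x : 'I_n -> X),
    normalized x -> unconditional_basic lambda x ->
    `|\sum_i x i| <= f lambda * Num.sqrt n%:R.

Definition disjointly_supported (X : normedModType R) (coef : X -> nat -> R)
    n (x : 'I_n -> X) : Prop :=
  forall i j, i != j -> forall m, coef (x i) m = 0 \/ coef (x j) m = 0.

Definition disjoint_upper_H (X : normedModType R) (coef : X -> nat -> R) : Prop :=
  exists M : R, forall n (x : 'I_n -> X),
    normalized x -> disjointly_supported coef x ->
    `|\sum_i x i| <= M * Num.sqrt n%:R.

Definition lower_H2 X : Prop :=
  exists C : R -> R -> R, forall (lambda delta : R), 0 < delta < 1 ->
    forall n (x : 'I_n -> X), normalized x -> unconditional_basic lambda x ->
    exists2 F : {set 'I_n}, delta * n%:R <= #|F|%:R &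
      forall a : 'I_n -> R,
        Num.sqrt (\sum_(i in F) `|a i| ^+ 2) <=
        C lambda delta * `|\sum_(i in F) a i *: x i|.

(* l_2^n is 'rV[R]_n with the following norm; the norm which the library puts
   on matrices is the maximum norm. *)
Definition l2norm n (v : 'rV[R]_n) : R := Num.sqrt (\sum_i v ord0 i ^+ 2).

(* Operators E -> l_2^n are given by functions on X; values off E are ignored. *)
Definition bounded_linear_on X (E : set X) n (T : X -> 'rV[R]_n) : Prop :=
  (forall a u v, E u -> E v -> T (a *: u + v) = a *: T u + T v) /\
  exists M : R, forall u, E u -> l2norm (T u) <= M * `|u|.

Definition op_norm X (E : set X) n (T : X -> 'rV[R]_n) : R :=
  sup [set l2norm (T u) | u in E `&` [set u | `|u| <= 1]].

Definition linear_subspace X (E : set X) : Prop :=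
  E 0 /\ forall (a : R) u v, E u -> E v -> E (a *: u + v).

(* Matrices act on row vectors from the right. *)
Definition orthogonal_projection n (P : 'M[R]_n) : Prop :=
  P *m P = P /\ P^T = P.

(* n >= 1: for n = 0 no projection has rank larger than delta * n. *)
Definition weak_type2 X : Prop :=
  exists C delta : R, 0 < delta < 1 /\
    forall (E : set X) n (T : X -> 'rV[R]_n), (0 < n)%N ->
      linear_subspace E -> bounded_linear_on E T ->
      exists (P : 'M[R]_n) (S : X -> 'rV[R]_n),
        [/\ orthogonal_projection P,
            delta * n%:R < (\rank P)%:R,
            bounded_linear_on setT S,
            forall u, E u -> S u = T u *m P &
            op_norm setT S <= C * op_norm E T].

Definition mutually_independent d (Omega : measurableType d)
    (P : probability Omega R) (g : nat -> {RV P >-> R}) : Prop :=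
  forall (J : {fset nat}) (B : nat -> set R), (forall j, measurable (B j)) ->
    P (\bigcap_(j in [set` J]) g j @^-1` B j) =
    (\prod_(j <- J) P (g j @^-1` B j))%E.

Definition standard_gaussian_sequence d (Omega : measurableType d)
    (P : probability Omega R) (g : nat -> {RV P >-> R}) : Prop :=
  mutually_independent g /\
  forall j (B : set R), measurable B ->
    distribution P (g j) B = normal_prob 0 1 B.

Definition cotype2 d (Omega : measurableType d) (P : probability Omega R)
    (g : nat -> {RV P >-> R}) X : Prop :=
  exists K : R, forall n (x : 'I_n -> X),
    ((Num.sqrt (\sum_j `|x j| ^+ 2))%:E <=
     K%:E * sqrte (\int[P]_t (`|\sum_(j < n) g j t *: x j| ^+ 2)%:E))%E.

End Banach_properties.

(* Main.v *)
Require Import Defs.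
From HB Require Import structures.
From mathcomp Require Import all_boot all_order all_algebra finmap.
From mathcomp Require Import all_classical all_reals all_analysis.
From mathcomp Require Import measurable_realfun.
From mathcomp Require Import ring lra zify.
Import Order.TTheory GRing.Theory Num.Theory.
Import numFieldNormedType.Exports.
Set Implicit Arguments.
Unset Strict Implicit.
Unset Printing Implicit Defensive.
Local Open Scope classical_set_scope.
Local Open Scope ring_scope.


(** Write t for the norm of T^2, D for the rearrangement and K for the constant
    relating t o D to the norm of X. Everything rests on two opposite facts.

    Euclidean range ([T2norm_ge_window]): on the positions from M to M 2^M the
    norm t is at least half the l_2 norm, since M doubling intervals starting at M
    are admissible and each of them is an admissible family of singletons. Hence
    [T2norm_copies_ge]: if a is normalised in l_2, and no M entries of v carry
    more than three quarters of its squared l_2 norm, then t (D (v (x) a)) is at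
    least a quarter of the l_2 norm of v, provided that M 2^M exceeds the length
    of v (x) a.

    Smallness ([small_T2norm]): there is a finite decreasing a >= 0, normalised
    in l_2, with t a <= eps. Its squares are a repeated average c of high order k.
    Unfolding the definition of t k times costs a factor 1/2 per level on the
    squares, and the coordinates that are reached earlier form a Schreier set of
    order at most k, which c hardly charges. As a is decreasing, t (D a) <= eps.

    The four failures all come from such an a.

    - Upper (H): n disjoint copies of a, with n large, have norms at most K eps,
      while their sum is 1_n (x) a, of norm at least a constant times sqrt n.

    - Lower (H_2): the unit vectors of X are symmetric up to constants. Among 2N
      of them any set F of at least N members carries a copy of a, with N the
      length of a; this combination has l_2 norm one and norm at most K eps.

    - Weak type 2: let U be an orthogonal n x n matrix with all entries of modulus
      n^(-1/2). In R^2n no vector (b, b U) has most of its mass on few coordinates,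
      by the uncertainty principle, so that (b, b U) (x) a has norm at least a
      constant times that of b in l_2. Hence the map T sending it to b is bounded
      independently of eps. If S extends P T then S maps each of the 2n copies of a,
      whose norms are at most K eps, to a vector of norm O(eps), and so the squared
      Hilbert-Schmidt norm of P, which is its rank, is O(n eps^2) instead of
      exceeding delta n.

    - Cotype 2: for the vectors a_j e_j the left-hand side is bounded below. On the
      right the multipliers |g_j| <= L give a vector of norm O(L eps), and the
      others one whose squared l_2 norm has mean at most the fourth moment of g_j
      over L^2. Taking L large first and then eps small makes the right-hand side
      tend to zero. *)

(** * Admissible families *)

Section Admissible.


(** The relation [fset_before] is transitive only through nonempty sets. *)
Lemma admissible_pairwise (Es : seq {fset nat}) :
  admissible Es -> pairwise fset_before Es.
Proof.
case/and4P => _ nz _; rewrite (@sorted_pairwise_in _ [pred E | E != fset0]) //.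
move=> F E G F0 _ _ /allrelP EF /allrelP FG.
have [f fF] := fset0Pn _ F0.
apply/allrelP => i j iE jG; exact: ltn_trans (EF _ _ iE fF) (FG _ _ fF jG).
Qed.

Lemma admissible_start (Es : seq {fset nat}) E n :
  admissible Es -> E \in Es -> n \in E -> (size Es <= n.+1)%N.
Proof.
move=> adm; move: (admissible_pairwise adm); case/and4P: adm.
case: Es => [//|F Es] _ /= /andP[/fset0Pn[f fF] _] st _ /andP[/allP FEs _].
rewrite inE => /predU1P[->|EEs] nE; first exact: (allP st).
have /allrelP FE := FEs _ EEs.
by rewrite (leq_trans (allP st _ fF))// ltnS ltnW//; exact: FE.
Qed.

Lemma admissible_count (Es : seq {fset nat}) n :
  admissible Es -> (\sum_(E <- Es) (n \in E) <= 1)%N.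
Proof.
move/admissible_pairwise; elim: Es => [|E Es IH] /=; first by rewrite big_nil.
move=> /andP[/allP EEs /IH {}IH]; rewrite big_cons.
have [nE|] := boolP (n \in E); last by [].
rewrite big1_seq // => F /andP[_ /EEs /allrelP EF]; apply/eqP; rewrite eqb0.
by apply/negP => /(EF _ _ nE) /=; rewrite ltnn.
Qed.

Lemma admissible1 n : admissible [:: [fset n]%fset].
Proof.
apply/and4P; split => //=.
- by rewrite andbT; apply/fset0Pn; exists n; rewrite inE.
- by apply/allP => m; rewrite inE => /eqP ->.
Qed.

Definition nat_interval (s e : nat) : {fset nat} := [fset i in index_iota s e]%fset.

Lemma in_nat_interval s e i : (i \in nat_interval s e) = (s <= i < e)%N.
Proof. by rewrite inE mem_index_iota. Qed.

Lemma admissible_intervals (f : nat -> nat) k :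
  (0 < k)%N -> (k <= (f 0).+1)%N -> (forall j, (f j < f j.+1)%N) ->
  admissible [seq nat_interval (f j) (f j.+1) | j <- index_iota 0 k].
Proof.
move=> k0 kf fS; apply/and4P; split.
- by rewrite size_map size_iota subn0.
- apply/allP => _ /mapP[j _ ->]; apply/fset0Pn; exists (f j).
  by rewrite in_nat_interval leqnn fS.
- case: k k0 kf => // k _ kf /=.
  apply/allP => i; rewrite size_map size_iota in_nat_interval => /andP[fi _].
  by rewrite (leq_trans kf)// ltnS.
- rewrite sorted_map; apply: (@sub_sorted _ ltn); last exact: iota_ltn_sorted.
  move=> i j ij; apply/allrelP => m n; rewrite !in_nat_interval => /andP[_ mi] /andP[jn _].
  apply: (leq_trans mi); apply: leq_trans jn.
  by apply: (homo_leq (r := leq)) ij => // [a b c|a]; [exact: leq_trans|exact: ltnW].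
Qed.

End Admissible.

(** * The norm of T^2 *)

Section TsirelsonNorm.
Context {R : realType}.
Implicit Types x y : nat -> R.

Lemma sup_norm_ge x n : (`|x n|%:E <= sup_norm x)%E.
Proof. by apply: ereal_sup_ubound; exists n. Qed.

Lemma sup_norm_ge0 x : (0 <= sup_norm x)%E.
Proof. exact: le_trans (sup_norm_ge x 0). Qed.

Lemma sup_norm_le x b : (forall n, `|x n|%:E <= b)%E -> (sup_norm x <= b)%E.
Proof. by move=> xb; apply: ge_ereal_sup => _ [n _ <-]. Qed.

Lemma restrict_le E x y : (forall n, `|x n| <= `|y n|) ->
  forall n, `|fset_restrict E x n| <= `|fset_restrict E y n|.
Proof. by move=> xy n; rewrite /fset_restrict; case: ifP; rewrite ?normr0. Qed.

Lemma stage_ge0 m x : (0 <= T2norm_stage m x)%E.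
Proof.
case: m => [|m] /=; first exact: sup_norm_ge0.
by rewrite le_max sup_norm_ge0.
Qed.

Lemma stage_ge m x n : (`|x n|%:E <= T2norm_stage m x)%E.
Proof.
case: m => [|m] /=; first exact: sup_norm_ge.
by rewrite le_max sup_norm_ge.
Qed.

Lemma stageS_le m m' x y : (sup_norm x <= sup_norm y)%E ->
  (forall E, T2norm_stage m (fset_restrict E x) <=
             T2norm_stage m' (fset_restrict E y))%E ->
  (T2norm_stage m.+1 x <= T2norm_stage m'.+1 y)%E.
Proof.
move=> xy Exy /=; rewrite ge_max le_max xy /= le_max; apply/orP; right.
apply: lee_wpmul2l; first by rewrite lee_fin invr_ge0 sqrtr_ge0.
apply: ge_ereal_sup => _ [Es Esadm <-].
apply: le_ereal_sup_tmp; eexists; first by exists Es.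
rewrite lee_sqrt; last by apply: sume_ge0 => E _; exact: sqre_ge0.
by apply: lee_sum => E _; rewrite lee_sqr ?stage_ge0.
Qed.

Lemma stage_mono m x y : (forall n, `|x n| <= `|y n|) ->
  (T2norm_stage m x <= T2norm_stage m y)%E.
Proof.
elim: m x y => [|m IH] x y xy.
  by apply: sup_norm_le => n; apply: le_trans (sup_norm_ge y n); rewrite lee_fin.
apply: stageS_le => [|E]; last exact/IH/restrict_le.
by apply: sup_norm_le => n; apply: le_trans (sup_norm_ge y n); rewrite lee_fin.
Qed.

Lemma stage_nondecreasing x : {homo (T2norm_stage ^~ x) : n m / (n <= m)%N >-> (n <= m)%E}.
Proof.
apply: homo_leq => // [a b c|m]; first exact: le_trans.
elim: m x => [|m IH] x; last by apply: stageS_le => // E; exact: IH.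
by rewrite /= le_max lexx.
Qed.

Lemma T2normE x : T2norm x = ereal_sup (range (T2norm_stage ^~ x)).
Proof.
apply/cvg_lim => //; apply: ereal_nondecreasing_cvgn; exact: stage_nondecreasing.
Qed.

Lemma stage_le_T2norm m x : (T2norm_stage m x <= T2norm x)%E.
Proof. by rewrite T2normE; apply: ereal_sup_ubound; exists m. Qed.

Lemma T2norm_le x b : (forall m, T2norm_stage m x <= b)%E -> (T2norm x <= b)%E.
Proof. by move=> xb; rewrite T2normE; apply: ge_ereal_sup => _ [m _ <-]. Qed.

Lemma T2norm_mono x y : (forall n, `|x n| <= `|y n|) -> (T2norm x <= T2norm y)%E.
Proof.
move=> xy; apply: T2norm_le => m.
exact: le_trans (stage_mono m xy) (stage_le_T2norm _ _).
Qed.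

Lemma stageS_ge m x Es (f : {fset nat} -> R) : admissible Es ->
  (forall E, E \in Es -> 0 <= f E) ->
  (forall E, E \in Es -> (f E)%:E <= T2norm_stage m (fset_restrict E x))%E ->
  ((Num.sqrt (2^-1 * \sum_(E <- Es) f E ^+ 2))%:E <= T2norm_stage m.+1 x)%E.
Proof.
move=> adm f0 fle /=; rewrite le_max; apply/orP; right.
rewrite sqrtrM ?invr_ge0// sqrtrV// EFinM lee_wpmul2l ?lee_fin ?invr_ge0 ?sqrtr_ge0//.
apply: le_ereal_sup_tmp; eexists; first by exists Es.
apply: (@le_trans _ _ (sqrte (\sum_(E <- Es) (f E ^+ 2)%:E)%E)); first by rewrite sumEFin.
rewrite lee_sqrt; last by apply: sume_ge0 => E _; exact: sqre_ge0.
rewrite !big_seq; apply: lee_sum => E EE.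
by rewrite EFin_expe lee_sqr ?stage_ge0 ?lee_fin ?f0 ?fle.
Qed.

(** The squared form of the recursion, in which the factor 2^(-1/2) becomes 2 on
    the side of the bound; all upper estimates below are inductions through it. *)
Lemma stageS_sqr_le m x (b : \bar R) :
  (forall n, (x n ^+ 2)%:E <= b)%E ->
  (forall Es, admissible Es ->
     \sum_(E <- Es) T2norm_stage m (fset_restrict E x) ^+ 2 <= 2%:E * b)%E ->
  (T2norm_stage m.+1 x ^+ 2 <= b)%E.
Proof.
move=> xb Eb; have b0 : (0 <= b)%E.
  by apply: le_trans (xb 0%N); rewrite lee_fin sqr_ge0.
case: b => [b| |] in xb Eb b0 *; rewrite ?leey//.
rewrite -(@sqr_sqrte _ b%:E)// lee_sqr ?sqrte_ge0 ?stage_ge0//=.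
rewrite ge_max; apply/andP; split.
  apply: sup_norm_le => n; rewrite lee_fin -sqrtr_sqr ler_sqrt; last by rewrite -lee_fin.
  by rewrite -lee_fin.
rewrite -lee_pdivlMl ?invr_gt0 ?sqrtr_gt0// invrK -EFinM -sqrtrM//.
apply: ge_ereal_sup => _ [Es adm <-].
rewrite -[leRHS]/(sqrte (2 * b)%:E) lee_sqrt ?EFinM ?Eb//.
by rewrite mule_ge0.
Qed.

End TsirelsonNorm.

(** * Comparison with l_2 *)

Section EuclideanComparison.
Context {R : realType}.
Implicit Types x y : nat -> R.

Definition supported_below L x := forall n, (L <= n)%N -> x n = 0.

Definition sqr_seq x : nat -> R := fun n => x n ^+ 2.

Lemma sqr_seq_ge0 x n : 0 <= sqr_seq x n.
Proof. exact: sqr_ge0. Qed.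

Lemma sqr_seq_restrict E x : sqr_seq (fset_restrict E x) = fset_restrict E (sqr_seq x).
Proof.
by apply/funext => n; rewrite /sqr_seq /fset_restrict; case: ifP; rewrite ?expr0n.
Qed.

Lemma supported_below_restrict L E x :
  supported_below L x -> supported_below L (fset_restrict E x).
Proof. by move=> xL n /xL xn; rewrite /fset_restrict xn if_same. Qed.

Lemma term_le_sum L x n : (forall i, 0 <= x i) -> supported_below L x ->
  x n <= \sum_(0 <= i < L) x i.
Proof.
move=> x0 xL; have [nL|/xL ->] := ltnP n L; last exact: sumr_ge0.
rewrite big_mkord (bigD1 (Ordinal nL))//= lerDl; exact: sumr_ge0.
Qed.

Lemma sum_restrict_le L x (Es : seq {fset nat}) : admissible Es ->
  (forall n, 0 <= x n) ->
  \sum_(E <- Es) \sum_(0 <= n < L) fset_restrict E x n <= \sum_(0 <= n < L) x n.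
Proof.
move=> adm x0; rewrite exchange_big /=; apply: ler_sum => n _.
rewrite (eq_bigr (fun E : {fset nat} => x n * (n \in E)%:R)); last first.
  by move=> E _; rewrite /fset_restrict; case: ifP; rewrite ?mulr1 ?mulr0.
rewrite -mulr_sumr -natr_sum ler_piMr//.
by rewrite (_ : 1 = 1%:R)// ler_nat admissible_count.
Qed.

Lemma sup_norm_sqr_le x (b : \bar R) :
  (forall n, (x n ^+ 2)%:E <= b)%E -> (sup_norm x ^+ 2 <= b)%E.
Proof.
move=> xb; have b0 : (0 <= b)%E.
  by apply: le_trans (xb 0%N); rewrite lee_fin sqr_ge0.
case: b => [b| |] in xb b0 *; rewrite ?leey//.
rewrite -(@sqr_sqrte _ b%:E)// lee_sqr ?sqrte_ge0 ?sup_norm_ge0//=.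
apply: sup_norm_le => n; rewrite lee_fin -sqrtr_sqr ler_sqrt; last by rewrite -lee_fin.
by rewrite -lee_fin.
Qed.

Lemma stage_le_l2 m L x : supported_below L x ->
  (T2norm_stage m x ^+ 2 <= (\sum_(0 <= n < L) sqr_seq x n)%:E)%E.
Proof.
have le1 y n : supported_below L y -> ((y n ^+ 2)%:E <= (\sum_(0 <= n < L) sqr_seq y n)%:E)%E.
  move=> yL; rewrite lee_fin; apply: (@term_le_sum _ (sqr_seq y)); first exact: sqr_seq_ge0.
  by move=> i /yL yi; rewrite /sqr_seq yi expr0n.
elim: m x => [|m IH] x xL; first by apply: sup_norm_sqr_le => n; exact: le1.
apply: stageS_sqr_le => [n|Es adm]; first exact: le1.
apply: (@le_trans _ _ (\sum_(E <- Es) (\sum_(0 <= n < L) sqr_seq (fset_restrict E x) n)%:E)%E).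
  by apply: lee_sum => E _; apply/IH/supported_below_restrict.
rewrite sumEFin -EFinM lee_fin.
under eq_bigr => E _ do rewrite sqr_seq_restrict.
apply: le_trans (sum_restrict_le L adm (sqr_seq_ge0 x)) _.
by rewrite ler_peMl ?ler1n// sumr_ge0// => n _; exact: sqr_seq_ge0.
Qed.

Lemma T2norm_le_l2 L x : supported_below L x ->
  (T2norm x <= (Num.sqrt (\sum_(0 <= n < L) sqr_seq x n))%:E)%E.
Proof.
move=> xL; apply: T2norm_le => m.
have s0 : 0 <= \sum_(0 <= n < L) sqr_seq x n by apply: sumr_ge0 => n _; exact: sqr_seq_ge0.
rewrite -lee_sqr ?stage_ge0 ?lee_fin ?sqrtr_ge0//.
by rewrite -EFin_expe sqr_sqrtr//; exact: stage_le_l2.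
Qed.

Lemma big_nat_interval s e (F : nat -> R) :
  \sum_(i <- nat_interval s e) F i = \sum_(s <= i < e) F i.
Proof.
apply/perm_big/uniq_perm; [exact: fset_uniq|exact: iota_uniq|].
by move=> i; rewrite in_nat_interval mem_index_iota.
Qed.

Lemma sum_intervals (f : nat -> nat) k (F : nat -> R) :
  (forall j, (f j < f j.+1)%N) ->
  \sum_(0 <= j < k) \sum_(f j <= i < f j.+1) F i = \sum_(f 0 <= i < f k) F i.
Proof.
move=> fS; elim: k => [|k IH]; first by rewrite !big_geq.
rewrite big_nat_recr//= IH -big_cat_nat//=; last exact: ltnW.
by apply: (homo_leq (r := leq)) (leq0n k) => // [a b c|a]; [exact: leq_trans|exact: ltnW].
Qed.

(** The hypothesis e - s <= s + 1 is the admissibility of the singletons of the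
    interval, the position of the index s being s + 1. *)
Lemma stage1_ge_interval x s e : (s < e)%N -> (e - s <= s.+1)%N ->
  ((Num.sqrt (2^-1 * \sum_(s <= i < e) sqr_seq x i))%:E <= T2norm_stage 1 x)%E.
Proof.
move=> se es; have se0 : (0 < e - s)%N by rewrite subn_gt0.
have fS j : (s + j < s + j.+1)%N by rewrite addnS.
have es0 : (e - s <= (s + 0).+1)%N by rewrite addn0.
have adm := @admissible_intervals (addn s) (e - s) se0 es0 fS.
have := @stageS_ge _ 0 x _ (fun E => \sum_(i <- E) `|x i|) adm.
have E1 j : \sum_(i <- nat_interval (s + j) (s + j.+1)) `|x i| = `|x (s + j)%N|.
  by rewrite big_nat_interval addnS big_nat1.
rewrite big_map; under eq_bigr => j _ do rewrite E1 real_normK ?num_real//.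
have -> : \sum_(s <= i < e) sqr_seq x i = \sum_(0 <= j < e - s) x (s + j)%N ^+ 2.
  by rewrite -[in LHS](add0n s) big_addn; apply: eq_bigr => i _; rewrite addnC.
apply=> [E _|_ /mapP[j _ ->]]; first exact: sumr_ge0.
rewrite E1; apply: le_trans (sup_norm_ge _ (s + j)).
by rewrite /fset_restrict in_nat_interval leqnn fS.
Qed.

(** The M intervals from M 2^j to M 2^(j+1) form an admissible family, and
    so do the singletons of each of them: two levels of the recursion, each with
    a factor 2^(-1/2), reach all the terms of the window. *)
Lemma T2norm_ge_window x M : (0 < M)%N ->
  ((2^-1 * Num.sqrt (\sum_(M <= i < M * 2 ^ M) sqr_seq x i))%:E <= T2norm x)%E.
Proof.
move=> M0; set f := fun j => (M * 2 ^ j)%N.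
have fS j : (f j < f j.+1)%N by rewrite /f ltn_pmul2l// ltn_exp2l.
have f0 : f 0 = M by rewrite /f expn0 muln1.
have adm := @admissible_intervals f M M0 (leq_trans (eq_leq (esym f0)) (leqnSn _)) fS.
apply: le_trans (stage_le_T2norm 2 x).
have := @stageS_ge _ 1 x _ (fun E => Num.sqrt (2^-1 * \sum_(i <- E) sqr_seq x i)) adm.
rewrite big_map (eq_bigr (fun j => 2^-1 * \sum_(f j <= i < f j.+1) sqr_seq x i)); last first.
  move=> j _; rewrite big_nat_interval sqr_sqrtr// mulr_ge0// sumr_ge0// => i _.
  exact: sqr_seq_ge0.
rewrite -mulr_sumr (sum_intervals _ _ fS) f0 mulrA -expr2 sqrtrM ?sqr_ge0//.
rewrite sqrtr_sqr ger0_norm ?invr_ge0//; apply=> [E _|_ /mapP[j _ ->]].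
  exact: sqrtr_ge0.
rewrite big_nat_interval.
have := @stage1_ge_interval (fset_restrict (nat_interval (f j) (f j.+1)) x) (f j) (f j.+1) (fS j).
rewrite (eq_big_nat _ _ (F2 := sqr_seq x)) => [|i ij]; last first.
  by rewrite /sqr_seq /fset_restrict in_nat_interval ij.
apply; rewrite leq_subLR /f expnS mulnCA mul2n -addnn.
by rewrite addnS leqW.
Qed.

End EuclideanComparison.

(** * Sequences of small norm *)

Section Schreier.
Context {R : realType}.
Implicit Types x y : nat -> R.

(** The recursion of the norm without its factor and with exactly k levels. For
    x >= 0 it is the supremum of the masses that x gives to the Schreier sets of
    order k. *)
Fixpoint schreier_norm (k : nat) x : \bar R :=
  if k is k'.+1 then
    ereal_sup [set (\sum_(E <- Es) schreier_norm k' (fset_restrict E x))%E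
              | Es in [set Es : seq {fset nat} | admissible Es]]
  else sup_norm x.

Lemma schreierS_ge k x Es : admissible Es ->
  (\sum_(E <- Es) schreier_norm k (fset_restrict E x) <= schreier_norm k.+1 x)%E.
Proof. by move=> adm; apply: ereal_sup_ubound; exists Es. Qed.

Lemma schreierS_le k x b :
  (forall Es, admissible Es ->
    \sum_(E <- Es) schreier_norm k (fset_restrict E x) <= b)%E ->
  (schreier_norm k.+1 x <= b)%E.
Proof. by move=> xb; apply: ge_ereal_sup => _ [Es adm <-]; exact: xb. Qed.

Lemma schreier_ge k x n : (`|x n|%:E <= schreier_norm k x)%E.
Proof.
elim: k x => [|k IH] x; first exact: sup_norm_ge.
apply: le_trans (schreierS_ge k x (admissible1 n)).
rewrite big_seq1; apply: le_trans (IH _).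
by rewrite /fset_restrict inE eqxx.
Qed.

Lemma schreier_ge0 k x : (0 <= schreier_norm k x)%E.
Proof. exact: le_trans (schreier_ge k x 0). Qed.

Lemma schreier_mono k x y : (forall n, `|x n| <= `|y n|) ->
  (schreier_norm k x <= schreier_norm k y)%E.
Proof.
elim: k x y => [|k IH] x y xy.
  by apply: sup_norm_le => n; apply: le_trans (sup_norm_ge y n); rewrite lee_fin.
apply: schreierS_le => Es adm; apply: le_trans (schreierS_ge k y adm).
by apply: lee_sum => E _; exact/IH/restrict_le.
Qed.

Lemma schreierD k x y :
  (schreier_norm k (fun n => x n + y n)%R <= schreier_norm k x + schreier_norm k y)%E.
Proof.
elim: k x y => [|k IH] x y.
  apply: sup_norm_le => n; apply: (le_trans _ (leeD (sup_norm_ge x n) (sup_norm_ge y n))).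
  by rewrite -EFinD lee_fin ler_normD.
apply: schreierS_le => Es adm.
apply: (le_trans _ (leeD (schreierS_ge k x adm) (schreierS_ge k y adm))).
rewrite -big_split /=; apply: lee_sum => E _.
apply: le_trans (IH _ _); apply: schreier_mono => n.
by rewrite /fset_restrict; case: ifP; rewrite ?addr0.
Qed.

Lemma schreierZ k x (c : R) : 0 <= c ->
  (schreier_norm k (fun n => c * x n)%R <= c%:E * schreier_norm k x)%E.
Proof.
move=> c0; elim: k x => [|k IH] x.
  apply: sup_norm_le => n; rewrite normrM ger0_norm// EFinM.
  by rewrite lee_wpmul2l ?lee_fin// sup_norm_ge.
apply: schreierS_le => Es adm.
apply: (@le_trans _ _ (c%:E * (\sum_(E <- Es) schreier_norm k (fset_restrict E x)))%E); last first.
  by rewrite lee_wpmul2l ?lee_fin//; exact: schreierS_ge.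
rewrite ge0_sume_distrr; last by move=> E _; exact: schreier_ge0.
apply: lee_sum => E _; apply: le_trans (IH _); apply: schreier_mono => n.
by rewrite /fset_restrict; case: ifP; rewrite ?mulr0.
Qed.

Lemma sum_schreier_le_l1 k L x Es : admissible Es -> (forall n, 0 <= x n) ->
  supported_below L x ->
  (forall y, (forall n, 0 <= y n) -> supported_below L y ->
    (schreier_norm k y <= (\sum_(0 <= n < L) y n)%:E)%E) ->
  (\sum_(E <- Es) schreier_norm k (fset_restrict E x) <= (\sum_(0 <= n < L) x n)%:E)%E.
Proof.
move=> adm x0 xL yb.
apply: (@le_trans _ _ (\sum_(E <- Es) (\sum_(0 <= n < L) fset_restrict E x n)%:E)%E).
  apply: lee_sum => E _; apply: yb; last exact: supported_below_restrict.
  by move=> n; rewrite /fset_restrict; case: ifP.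
by rewrite sumEFin lee_fin sum_restrict_le.
Qed.

Lemma schreier_le_l1 k L x : (forall n, 0 <= x n) -> supported_below L x ->
  (schreier_norm k x <= (\sum_(0 <= n < L) x n)%:E)%E.
Proof.
elim: k x => [|k IH] x x0 xL.
  by apply: sup_norm_le => n; rewrite ger0_norm// lee_fin; exact: term_le_sum.
by apply: schreierS_le => Es adm; exact: sum_schreier_le_l1 IH.
Qed.

(** Unfolding the recursion of the norm k times: each level contributes a factor
    1/2 to the squares, so that the terms lying k levels deep are paid for by the
    first summand; those reached in fewer levels form a Schreier set of order k. *)
Lemma stage_le_schreier k m L x : supported_below L x ->
  (T2norm_stage m x ^+ 2 <=
   (2^-1 ^+ k * \sum_(0 <= n < L) sqr_seq x n)%:E + schreier_norm k (sqr_seq x))%E.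
Proof.
have sum0 y : 0 <= \sum_(0 <= n < L) sqr_seq y n.
  by apply: sumr_ge0 => n _; exact: sqr_seq_ge0.
have pow0 j : 0 <= 2^-1 ^+ j :> R by rewrite exprn_ge0 ?invr_ge0.
have term_le j y n : ((y n ^+ 2)%:E <=
   (2^-1 ^+ j * \sum_(0 <= n < L) sqr_seq y n)%:E + schreier_norm j (sqr_seq y))%E.
  apply: (@le_trans _ _ (schreier_norm j (sqr_seq y))).
    have := schreier_ge j (sqr_seq y) n.
    by rewrite ger0_norm ?sqr_seq_ge0.
  by rewrite leeDr// lee_fin mulr_ge0.
elim: k m x => [|k IH] m x xL.
  apply: le_trans (stage_le_l2 m xL) _.
  by rewrite expr0 mul1r leeDl// schreier_ge0.
case: m => [|m]; first by apply: sup_norm_sqr_le => n; exact: term_le.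
apply: stageS_sqr_le => [n|Es adm]; first exact: term_le.
apply: (@le_trans _ _ (\sum_(E <- Es) ((2^-1 ^+ k * \sum_(0 <= n < L) sqr_seq (fset_restrict E x) n)%:E
   + schreier_norm k (fset_restrict E (sqr_seq x))))%E).
  apply: lee_sum => E _; rewrite -[in X in (_ + X)%E]sqr_seq_restrict.
  exact/IH/supported_below_restrict.
rewrite big_split /= sumEFin -mulr_sumr ge0_muleDr ?lee_fin ?mulr_ge0//; last exact: (schreier_ge0 k.+1).
apply: leeD.
  rewrite -EFinM lee_fin [leRHS](_ : _ = 2^-1 ^+ k * \sum_(0 <= n < L) sqr_seq x n); last by rewrite exprS; field.
  rewrite ler_wpM2l//.
  under eq_bigr => E _ do rewrite sqr_seq_restrict.
  exact: sum_restrict_le adm (sqr_seq_ge0 x).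
apply: le_trans (schreierS_ge k (sqr_seq x) adm) _.
by rewrite lee_pemull ?(schreier_ge0 k.+1)// lee_fin ler1n.
Qed.

(** Positivity up to the end of the interval makes it possible to append a further
    block that stays below the last term. *)
Definition decreasing_block s e (c : nat -> R) :=
  [/\ (s < e)%N, forall n, c n != 0 -> (s <= n < e)%N,
      forall n, (s <= n < e)%N -> 0 < c n &
      forall n, (s <= n)%N -> c n.+1 <= c n].

Lemma block_ge0 s e c : decreasing_block s e c -> forall n, 0 <= c n.
Proof.
move=> [_ c0 cp _] n; have [->//|/c0 n_in] := eqVneq (c n) 0.
exact/ltW/cp.
Qed.

Lemma block_supported s e c : decreasing_block s e c -> supported_below e c.
Proof.
move=> [_ c0 _ _] n en; apply/eqP; apply: contraT => /c0 /andP[_].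
by rewrite ltnNge en.
Qed.

(** An admissible family that meets v has at most e members, so it sees at most e
    times the Schreier norm of c on c; any other family sees c only, hence no more
    than its total mass. *)
Lemma schreierS_append k s e f (v c : nat -> R) (b eta : R) :
  decreasing_block s e v -> decreasing_block e f c ->
  \sum_(0 <= n < f) c n <= b + e%:R * eta ->
  (schreier_norm k.+1 v <= b%:E)%E -> (schreier_norm k c <= eta%:E)%E ->
  (schreier_norm k.+1 (fun n => v n + c n)%R <= (b + e%:R * eta)%:E)%E.
Proof.
move=> vB cB c1 vb ceta; apply: schreierS_le => Es adm.
have [Ese|eEs] := leqP (size Es) e.
  apply: (@le_trans _ _ (\sum_(E <- Es) (schreier_norm k (fset_restrict E v) + eta%:E))%E).
    apply: lee_sum => E _; apply: (le_trans _ (leeD (lexx _) ceta)).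
    apply: (le_trans _ (schreierD k _ _)); apply: schreier_mono => n.
    rewrite /fset_restrict; case: ifP => // _; rewrite normr0; exact: normr_ge0.
  rewrite big_split /= EFinD; apply: leeD; first exact: le_trans (schreierS_ge _ _ adm) vb.
  have eta0 : 0 <= eta by rewrite -lee_fin; exact: le_trans (schreier_ge0 _ _) ceta.
  by rewrite sumEFin lee_fin big_const_seq count_predT iter_addr_0 -[eta *+ _]mulr_natl ler_wpM2r// ler_nat.
apply: (@le_trans _ _ (\sum_(E <- Es) (schreier_norm k (fset_restrict E c)))%E).
  rewrite !big_seq; apply: lee_sum => E EEs; apply: schreier_mono => n.
  rewrite /fset_restrict; case: ifP => // nE.
  rewrite (block_supported vB) ?add0r//.
  by rewrite -ltnS (leq_trans eEs)// (admissible_start adm EEs).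
apply: le_trans (sum_schreier_le_l1 adm (block_ge0 cB) (block_supported cB) _) _.
  by move=> y y0 yf; exact: schreier_le_l1.
by rewrite lee_fin.
Qed.

Lemma append_block s e f (v c : nat -> R) :
  decreasing_block s e v -> decreasing_block e f c -> c e <= v e.-1 ->
  decreasing_block s f (fun n => v n + c n).
Proof.
move=> vB cB cv; have [se v_in v_gt0 v_dec] := vB; have [ef c_in c_gt0 c_dec] := cB.
have v0 := block_supported vB; have cn0 n : (n < e)%N -> c n = 0.
  by move=> ne; apply/eqP; apply: contraT => /c_in; rewrite leqNgt ne.
split.
- exact: ltn_trans ef.
- move=> n; have [ne|en] := ltnP n e.
    by rewrite cn0// addr0 => /v_in /andP[-> _]; exact: ltn_trans ef.
  by rewrite v0// add0r => /c_in/andP[_ ->]; rewrite (leq_trans (ltnW se)).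
- move=> n /andP[sn nf]; have [ne|en] := ltnP n e.
    by rewrite cn0// addr0 v_gt0// sn.
  by rewrite v0// add0r c_gt0// en.
- move=> n sn; have [ne|en] := ltnP n.+1 e.
    by rewrite !cn0// ?addr0 ?v_dec// ltnW.
  have [ne|ne] := leqP e n; first by rewrite !v0// ?add0r ?c_dec// leqW.
  have En : e = n.+1 by apply/eqP; rewrite eqn_leq en ne.
  by move: cv; rewrite (v0 n.+1)// (cn0 n)// add0r addr0 En.
Qed.

Lemma scale_block s e (v : nat -> R) (c : R) : 0 < c ->
  decreasing_block s e v -> decreasing_block s e (fun n => c * v n).
Proof.
move=> c0 [se v_in v_gt0 v_dec]; split=> // n.
- by rewrite mulf_eq0 negb_or => /andP[_ /v_in].
- by move=> /v_gt0 vn; rewrite mulr_gt0.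
- by move=> /v_dec vn; rewrite ler_wpM2l// ltW.
Qed.

(** For order k + 1, average n blocks of order k, each so thin with respect to the
    end of the preceding ones that an admissible family meeting an earlier block
    sees almost nothing of the later ones. So an admissible family sees at most
    one block entirely, which has weight 1/n. *)
Lemma repeated_average k s (eps : R) : 0 < eps ->
  exists c e, [/\ decreasing_block s e c, \sum_(0 <= n < e) c n = 1 &
                  (schreier_norm k c <= eps%:E)%E].
Proof.
elim: k s eps => [|k IH] s eps eps0.
  have [n n0 neps] : exists2 n, (0 < n)%N & n%:R^-1 <= eps.
    exists (Num.trunc eps^-1).+1 => //; rewrite invf_ple ?posrE//.
    exact/ltW/truncnS_gt.
  exists (fun i => if (s <= i < s + n)%N then n%:R^-1 else 0), (s + n)%N.
  have n1 : 0 < n%:R^-1 :> R by rewrite invr_gt0 ltr0n.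
  split.
  - split.
    + by rewrite -[ltnLHS]addn0 ltn_add2l.
    + by move=> i; case: ifP => //; rewrite eqxx.
    + by move=> i ->.
    + move=> i si; rewrite si (leqW si)/=; case: ltnP => [/ltnW ->//|_].
      by case: ifP => // _; exact: ltW.
  - rewrite (big_cat_nat _ (n := s)) ?leq_addr//= big1_seq ?add0r => [|i]; last first.
      by rewrite mem_index_iota => /andP[_ /andP[_ si]]; rewrite leqNgt si.
    rewrite (eq_big_nat _ _ (F2 := fun=> n%:R^-1)) => [|i ->//].
    by rewrite sumr_const_nat addKn -[LHS]mulr_natr mulVf// pnatr_eq0 -lt0n.
  - apply: sup_norm_le => i; rewrite lee_fin; case: ifP => _; last by rewrite normr0 ltW.
    by rewrite ger0_norm// ltW.
have [n neps] : exists n, n.+1%:R^-1 <= eps / 2.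
  exists (Num.trunc (eps / 2)^-1); rewrite invf_ple ?posrE ?divr_gt0//.
  exact/ltW/truncnS_gt.
(* v is the sum of n + 1 blocks, before normalisation. *)
suff [v [e [vB v1 vS]]] : exists v e, [/\ decreasing_block s e v,
    \sum_(0 <= n < e) v n = n.+1%:R & (schreier_norm k.+1 v <= (1 + n%:R * (eps / 2))%:E)%E].
  have n0 : 0 < n.+1%:R^-1 :> R by rewrite invr_gt0.
  exists (fun i => n.+1%:R^-1 * v i), e; split; first exact: scale_block.
    by rewrite -mulr_sumr v1 mulVf.
  apply: (le_trans (schreierZ _ _ (ltW n0))).
  apply: (@le_trans _ _ (n.+1%:R^-1%:E * (1 + n%:R * (eps / 2))%:E)%E).
    by rewrite lee_wpmul2l// lee_fin ltW.
  rewrite -EFinM lee_fin mulrDr mulr1 [leRHS]splitr lerD//.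
  rewrite [leLHS]mulrA ler_piMl ?divr_ge0 ?ltW//.
  by rewrite mulrC ltr_pdivrMr// mul1r ltr_nat.
elim: n {neps} => [|n [v [e [vB v1 vS]]]].
  have [c [e [cB c1 cS]]] := IH s 1 ltr01; exists c, e; split => //.
  rewrite mul0r addr0 -c1; apply: schreier_le_l1; [exact: block_ge0 cB|exact: block_supported cB].
have [se _ vgt _] := vB.
have ve : 0 < v e.-1 by apply: vgt; rewrite -ltnS prednK// (leq_ltn_trans _ se)//= se leqnn.
have e0 : 0 < e%:R :> R by rewrite ltr0n (leq_ltn_trans _ se).
(* The first bound keeps the sequence decreasing, as the sup norm is below every
   Schreier norm; the second one makes e members of a family see at most eps / 2. *)
pose eta := Num.min (v e.-1) (eps / 2 / e%:R).
have eta0 : 0 < eta by rewrite lt_min ve !divr_gt0.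
have [c [f [cB c1 cS]]] := IH e eta eta0.
have [ef _ cgt _] := cB.
exists (fun i => v i + c i), f; split.
- apply: append_block vB cB _; rewrite -lee_fin.
  apply: le_trans (le_trans _ cS) _; last by rewrite lee_fin ge_min lexx.
  by have := schreier_ge k c e; rewrite ger0_norm// ltW// cgt// leqnn.
- rewrite big_split /= c1 (big_cat_nat _ (n := e))//=; last exact: ltnW.
  rewrite v1 [X in _ + X + _]big1_seq ?addr0 ?natr1// => i.
  by rewrite mem_index_iota => /andP[_ /andP[ei _]]; exact: (block_supported vB).
- apply: le_trans (@schreierS_append k s e f v c (1 + n%:R * (eps / 2)) eta vB cB _ vS cS) _.
    by rewrite c1 -addrA lerDl addr_ge0 ?mulr_ge0 ?divr_ge0// ltW.
  rewrite lee_fin -addrA lerD2l -[n.+1%:R]natr1 mulrDl mul1r lerD2l mulrC -ler_pdivlMr//.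
  by rewrite ge_min lexx orbT.
Qed.

(** Take for a the square roots of a repeated average of order k with
    2^-k <= eps^2 / 2, and apply [stage_le_schreier]. *)
Lemma small_T2norm (eps : R) : 0 < eps -> exists (a : nat -> R) N,
  [/\ (0 < N)%N, supported_below N a, forall n, 0 <= a n.+1 <= a n,
      0 < a 0 /\ \sum_(0 <= n < N) sqr_seq a n = 1 & (T2norm a <= eps%:E)%E].
Proof.
move=> eps0; have e20 : 0 < eps ^+ 2 / 2 by rewrite divr_gt0// exprn_gt0.
have [k keps] : exists k, 2^-1 ^+ k <= eps ^+ 2 / 2.
  have /cvgrPdist_le/(_ _ e20)[k _ /(_ k (leqnn k))] : 2^-1 ^+ n @[n --> \oo] --> (0 : R).
    by apply: cvg_expr; rewrite ger0_norm ?invr_ge0// invf_lt1// ltr1n.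
  by rewrite sub0r normrN ger0_norm ?exprn_ge0 ?invr_ge0// => kle; exists k.
have [c [N [cB c1 cS]]] := @repeated_average k 0 _ e20.
have [N0 _ cgt cdec] := cB; have c0 := block_ge0 cB.
have sqE : sqr_seq (fun n => Num.sqrt (c n)) = c.
  by apply/funext => n; rewrite /sqr_seq sqr_sqrtr.
have aN : supported_below N (fun n => Num.sqrt (c n)).
  by move=> n Nn; rewrite (block_supported cB)// sqrtr0.
exists (fun n => Num.sqrt (c n)), N; split => //.
- by move=> n; rewrite sqrtr_ge0 ler_wsqrtr// cdec.
- by rewrite sqE c1 sqrtr_gt0 cgt.
- apply: T2norm_le => m; rewrite -lee_sqr ?stage_ge0 ?lee_fin ?(ltW eps0)//.
  apply: (le_trans (stage_le_schreier k m aN)); rewrite sqE c1 mulr1.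
  apply: (le_trans (leeD (lexx _) cS)).
  by rewrite -EFinD -EFin_expe lee_fin [leRHS]splitr lerD.
Qed.

End Schreier.

(** * Rearrangements of finitely supported sequences *)

Section Rearrangement.
Context {R : realType}.
Implicit Types x y : nat -> R.

Lemma ler_sum_subseq (s r : seq nat) (F : nat -> R) : uniq s -> uniq r ->
  {subset s <= r} -> (forall i, 0 <= F i) -> \sum_(i <- s) F i <= \sum_(i <- r) F i.
Proof.
move=> su ru sr F0; rewrite [leRHS](bigID (mem s)) /= -[X in _ <= X + _]big_filter.
rewrite (perm_big s (r1 := [seq i <- r | i \in s])) /=; first by rewrite lerDl sumr_ge0.
apply: uniq_perm => //; first exact: filter_uniq.
by move=> i; rewrite mem_filter andb_idr// => /sr.
Qed.

Lemma rearrangement_nonincreasing x y : is_rearrangement x y ->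
  forall m n, (m <= n)%N -> `|y n| <= `|y m|.
Proof.
move=> [ydec _]; apply: (homo_leq (r := fun u v : R => v <= u)) => // a b c ba cb.
exact: le_trans cb ba.
Qed.

(** The n-th term of a rearrangement is determined by how many terms of the
    sequence exceed each level. If |y2 n| < |y1 n| then the first n + 1 terms of y1
    come from n + 1 terms of x2 that all appear in y2 before the index n. *)
Lemma rearrangement_le x1 x2 y1 y2 (phi : nat -> nat) :
  is_rearrangement x1 y1 -> is_rearrangement x2 y2 ->
  {in [pred m | x1 m != 0] &, injective phi} ->
  (forall m, `|x1 m| <= `|x2 (phi m)|) ->
  forall n, `|y1 n| <= `|y2 n|.
Proof.
move=> xy1 xy2 phi_inj le12 n; rewrite leNgt; apply/negP => lt21.
have dec1 := rearrangement_nonincreasing xy1.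
have dec2 := rearrangement_nonincreasing xy2.
have [_ [p1 [p1x p1_inj _] p1E]] := xy1.
have [_ [p2 [_ p2_inj p2_surj] p2E]] := xy2.
have y1_neq0 (i : 'I_n.+1) : y1 i != 0.
  rewrite -normr_gt0 (lt_le_trans _ (dec1 i n _)) ?(le_lt_trans _ lt21)//.
  by rewrite -ltnS.
have /choice[q qE] : forall i : 'I_n.+1, exists j : 'I_n, p2 j = phi (p1 i).
  move=> i; have x1i : `|y1 n| <= `|x2 (phi (p1 i))|.
    by rewrite (le_trans _ (le12 _))// -p1E// dec1// -ltnS.
  have : (x2 (phi (p1 i)) != 0) by rewrite -normr_gt0 (lt_le_trans _ x1i)// (le_lt_trans _ lt21).
  move=> /p2_surj[j /= y2j p2j].
  have jn : (j < n)%N.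
    rewrite ltnNge; apply/negP => /dec2; rewrite leNgt (lt_le_trans lt21)//.
    by rewrite p2E// p2j.
  by exists (Ordinal jn).
have q_inj : injective q.
  move=> i j qij; apply/val_inj/p1_inj; [exact/mem_set/y1_neq0|exact/mem_set/y1_neq0|].
  by apply: phi_inj; rewrite ?inE -?p1E ?y1_neq0// -!qE qij.
by have := leq_card q q_inj; rewrite !card_ord ltnn.
Qed.

(** A concrete rearrangement, on which sums can be computed; by [rearrangement_le]
    its terms have the same absolute values as those of [Drearr x]. *)
Definition sorted_positions L x :=
  sort (fun i j => `|x j| <= `|x i|) (iota 0 L).

Lemma perm_sorted_positions L x : perm_eq (sorted_positions L x) (iota 0 L).
Proof. exact: permEl (perm_sort _ _). Qed.

Lemma size_sorted_positions L x : size (sorted_positions L x) = L.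
Proof. by rewrite size_sort size_iota. Qed.

Lemma uniq_sorted_positions L x : uniq (sorted_positions L x).
Proof. by rewrite sort_uniq iota_uniq. Qed.

Lemma mem_sorted_positions L x i : (i \in sorted_positions L x) = (i < L)%N.
Proof. by rewrite mem_sort mem_iota add0n. Qed.

Definition sorted_terms L x n :=
  if (n < L)%N then x (nth 0%N (sorted_positions L x) n) else 0.

Lemma sorted_terms_rearrangement L x :
  supported_below L x -> is_rearrangement x (sorted_terms L x).
Proof.
move=> xL; set s := sorted_positions L x.
have sL := size_sorted_positions L x.
split.
  move=> n; rewrite /sorted_terms; case: ifPn => [n1|_]; last by rewrite normr0.
  rewrite (ltnW n1).
  have : sorted (fun i j => `|x j| <= `|x i|) s.
    by apply: sort_sorted => i j; exact: le_total.
  by move=> /(sortedP 0%N)/(_ n); rewrite sL; apply.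
exists (nth 0%N s) => [|n]; last by rewrite /sorted_terms; case: ifP; rewrite ?eqxx.
split.
- by move=> n /=; rewrite /sorted_terms; case: ifP => // _; rewrite eqxx.
- move=> m n; rewrite !inE /= /sorted_terms; case: ifP; rewrite ?eqxx// => mL _.
  case: ifP; rewrite ?eqxx// => nL _ /eqP.
  by rewrite nth_uniq ?sL ?uniq_sorted_positions// => /eqP.
- move=> m /= xm; have mL : (m < L)%N by rewrite ltnNge; apply: contra xm => /xL ->.
  have ms : m \in s by rewrite mem_sorted_positions.
  exists (index m s); last exact: nth_index.
  by rewrite /= /sorted_terms -{1}sL index_mem ms nth_index.
Qed.

Lemma Drearr_rearrangement L x :
  supported_below L x -> is_rearrangement x (Drearr x).
Proof.
move=> xL; apply: (@xgetPex _ (fun=> 0) [set y | is_rearrangement x y]).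
by exists (sorted_terms L x); exact: sorted_terms_rearrangement.
Qed.

Lemma normr_Drearr L x n : supported_below L x -> `|Drearr x n| = `|sorted_terms L x n|.
Proof.
move=> xL; have D := Drearr_rearrangement xL; have S := sorted_terms_rearrangement xL.
by apply/eqP; rewrite eq_le; apply/andP; split;
  [apply: (rearrangement_le (phi := id) D S)|apply: (rearrangement_le (phi := id) S D)].
Qed.

Lemma T2norm_Drearr L x :
  supported_below L x -> T2norm (Drearr x) = T2norm (sorted_terms L x).
Proof.
by move=> xL; apply/eqP; rewrite eq_le; apply/andP; split;
  apply: T2norm_mono => n; rewrite (normr_Drearr n xL).
Qed.

Lemma T2norm_Drearr_mono L1 L2 x1 x2 (phi : nat -> nat) :
  supported_below L1 x1 -> supported_below L2 x2 ->
  {in [pred m | x1 m != 0] &, injective phi} ->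
  (forall m, `|x1 m| <= `|x2 (phi m)|) ->
  (T2norm (Drearr x1) <= T2norm (Drearr x2))%E.
Proof.
move=> x1L x2L phi_inj le12; apply: T2norm_mono.
exact: rearrangement_le (Drearr_rearrangement x1L) (Drearr_rearrangement x2L) phi_inj le12.
Qed.

Lemma T2norm_Drearr_decreasing L x : supported_below L x ->
  (forall n, 0 <= x n.+1 <= x n) -> (T2norm (Drearr x) <= T2norm x)%E.
Proof.
move=> xL xdec; have x0 n : 0 <= x n.
  by have /andP[x1 x2] := xdec n; exact: le_trans x2.
apply: T2norm_mono; apply: (rearrangement_le (phi := id) (Drearr_rearrangement xL)) => //.
split; first by move=> n; rewrite !ger0_norm//; have /andP[] := xdec n.
by exists id => //; split => // n xn; exists n.
Qed.

Lemma sum_sorted_terms L x m : (m <= L)%N ->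
  \sum_(0 <= n < m) sqr_seq (sorted_terms L x) n =
  \sum_(i <- take m (sorted_positions L x)) sqr_seq x i.
Proof.
move=> mL; have ms : size (take m (sorted_positions L x)) = m.
  by rewrite size_takel// size_sorted_positions.
rewrite [RHS](big_nth 0%N) ms; apply: eq_big_nat => i /andP[_ im].
by rewrite /sqr_seq /sorted_terms (leq_trans im mL) nth_take.
Qed.

Lemma sum_sorted_terms_all L x :
  \sum_(0 <= n < L) sqr_seq (sorted_terms L x) n = \sum_(0 <= n < L) sqr_seq x n.
Proof.
rewrite sum_sorted_terms// take_oversize ?size_sorted_positions//.
rewrite (perm_big _ (perm_sorted_positions L x)) /index_iota subn0//.
Qed.

Lemma sorted_terms_supported L x : supported_below L (sorted_terms L x).
Proof. by move=> n; rewrite /sorted_terms ltnNge => ->. Qed.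

Lemma T2norm_Drearr_le_l2 L x : supported_below L x ->
  (T2norm (Drearr x) <= (Num.sqrt (\sum_(0 <= n < L) sqr_seq x n))%:E)%E.
Proof.
move=> xL; rewrite (T2norm_Drearr xL) -sum_sorted_terms_all.
exact/T2norm_le_l2/sorted_terms_supported.
Qed.

Lemma T2norm_Drearr_ge_term L x n : supported_below L x ->
  (`|x n|%:E <= T2norm (Drearr x))%E.
Proof.
move=> xL; have [nL|/xL ->] := ltnP n L; last first.
  by rewrite normr0 (le_trans _ (stage_le_T2norm 0 _))// stage_ge0.
rewrite (T2norm_Drearr xL); apply: le_trans (stage_le_T2norm 0 _).
apply: le_trans (stage_ge 0 _ (index n (sorted_positions L x))).
have ns : n \in sorted_positions L x by rewrite mem_sorted_positions.
have := ns; rewrite -index_mem size_sorted_positions /sorted_terms => ->.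
by rewrite nth_index.
Qed.

(** The tensor product of v and a, with the q-th multiple of a on the q-th interval
    of length N. *)
Definition copies N (v a : nat -> R) : nat -> R :=
  fun m => v (m %/ N)%N * a (m %% N)%N.

Lemma copies_supported N n v a : (0 < N)%N ->
  supported_below n v -> supported_below (n * N) (copies N v a).
Proof. by move=> N0 vn m nm; rewrite /copies vn ?mul0r// leq_divRL. Qed.

Lemma sum_copies N n v a (P : pred nat) : (0 < N)%N ->
  \sum_(0 <= m < n * N | P (m %/ N)%N) sqr_seq (copies N v a) m =
  (\sum_(0 <= q < n | P q) sqr_seq v q) * \sum_(0 <= r < N) sqr_seq a r.
Proof.
move=> N0; rewrite big_mkcond /= big_nat_mul mulr_suml [RHS]big_mkcond /=.
apply: eq_bigr => q _; rewrite mulSn addnC.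
rewrite -{1}(add0n (q * N)%N) big_addn addKn.
rewrite (eq_big_nat _ _ (F2 := fun r => if P q then sqr_seq v q * sqr_seq a r else 0)) => [|r /andP[_ rN]].
  by case: (P q); [rewrite -mulr_sumr|rewrite big1].
rewrite addnC divnMDl// divn_small// addn0; case: ifP => // _.
by rewrite /sqr_seq /copies divnMDl// divn_small// addn0 modnMDl modn_small// exprMn.
Qed.

(** The M largest terms of the tensor product lie in at most M copies, so a quarter
    of the mass of the rearranged sequence lies beyond them, at positions between M
    and M 2^M, where [T2norm_ge_window] applies. *)
Lemma T2norm_copies_ge (v a : nat -> R) n N M : (0 < N)%N -> (0 < M)%N ->
  (n * N <= M * 2 ^ M)%N -> supported_below n v ->
  \sum_(0 <= r < N) sqr_seq a r = 1 ->
  (forall A : seq nat, (size A <= M)%N ->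
    \sum_(0 <= q < n | q \in A) sqr_seq v q <= 3 / 4 * \sum_(0 <= q < n) sqr_seq v q) ->
  ((4^-1 * Num.sqrt (\sum_(0 <= q < n) sqr_seq v q))%:E <=
   T2norm (Drearr (copies N v a)))%E.
Proof.
move=> N0 M0 nNM vn a1 vA; set z := copies N v a; set S := \sum_(0 <= q < n) _.
have S0 : 0 <= S by apply: sumr_ge0 => q _; exact: sqr_seq_ge0.
have zL : supported_below (M * 2 ^ M) z.
  by move=> m nm; rewrite /z (copies_supported a N0 vn)// (leq_trans nNM).
have ML : (M <= M * 2 ^ M)%N by rewrite leq_pmulr// expn_gt0.
rewrite (T2norm_Drearr zL); apply: le_trans (T2norm_ge_window _ M0).
have zS : \sum_(0 <= m < M * 2 ^ M) sqr_seq z m = S.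
  rewrite (big_cat_nat _ (n := n * N))//= [X in _ + X]big1_seq ?addr0 => [|m].
    by have := sum_copies n v a predT N0; rewrite a1 mulr1.
  rewrite mem_index_iota => /andP[_ /andP[nm _]].
  by rewrite /sqr_seq /z (copies_supported a N0 vn)// expr0n.
have := sum_sorted_terms_all (M * 2 ^ M) z.
rewrite zS (big_cat_nat _ (n := M))//= sum_sorted_terms//.
set t := take M _ => tS.
have t_le : \sum_(i <- t) sqr_seq z i <= 3 / 4 * S.
  have tu : uniq t by rewrite take_uniq// uniq_sorted_positions.
  have st : (size (map (fun i => i %/ N)%N t) <= M)%N.
    by rewrite size_map size_take_min geq_minl.
  apply: le_trans (vA _ st).
  have := sum_copies n v a (mem (map (fun i => i %/ N)%N t)) N0; rewrite a1 mulr1 => <-.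
  rewrite (bigID (fun i => (i < n * N)%N)) /= [X in _ + X]big1 ?addr0 => [|i]; last first.
    by rewrite -leqNgt => /(copies_supported a N0 vn) zi; rewrite /sqr_seq /z zi expr0n.
  rewrite -big_filter -[leRHS]big_filter; apply: ler_sum_subseq => //.
  - exact: filter_uniq.
  - exact/filter_uniq/iota_uniq.
  - move=> i; rewrite !mem_filter mem_index_iota /= => /andP[-> it].
    by rewrite andbT; apply/mapP; exists i.
  - exact: sqr_seq_ge0.
have -> : 4^-1 * Num.sqrt S = 2^-1 * Num.sqrt (2^-1 ^+ 2 * S).
  by rewrite sqrtrM ?sqr_ge0// sqrtr_sqr ger0_norm ?invr_ge0//; lra.
rewrite lee_fin ler_pM2l ?invr_gt0// ler_sqrt; last first.
  by rewrite sumr_ge0// => i _; exact: sqr_seq_ge0.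
by move: tS t_le; rewrite -/z; lra.
Qed.

End Rearrangement.

(** * Matrices *)

Section Matrices.
Context {R : realType}.

(** Write P = C D with C and D of full rank; then D C = 1, and tr (C D) = tr (D C). *)
Lemma mxtrace_idempotent n (P : 'M[R]_n) : P *m P = P -> \tr P = (\rank P)%:R.
Proof.
move=> PP; rewrite -[in LHS](mulmx_base P) mxtrace_mulC.
suff -> : row_base P *m col_base P = 1%:M by rewrite mxtrace1.
move: (col_base_full P) (row_base_free P) (mulmx_base P).
move: (col_base P) (row_base P) => C D fullC freeD CD.
apply: (row_full_inj fullC); apply: (row_free_inj freeD) => /=.
by rewrite mulmx1 -!mulmxA CD mulmxA CD PP.
Qed.

Definition hs_norm2 m n (A : 'M[R]_(m, n)) : R := \tr (A *m A^T).

Lemma hs_norm2E m n (A : 'M[R]_(m, n)) : hs_norm2 A = \sum_i \sum_j A i j ^+ 2.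
Proof.
by apply: eq_bigr => i _; rewrite !mxE; apply: eq_bigr => j _; rewrite !mxE expr2.
Qed.

Lemma hs_norm2_ge0 m n (A : 'M[R]_(m, n)) : 0 <= hs_norm2 A.
Proof. by rewrite hs_norm2E !sumr_ge0// => i _; apply: sumr_ge0 => j _; exact: sqr_ge0. Qed.

Lemma hs_norm2D m n (A B : 'M[R]_(m, n)) :
  hs_norm2 (A + B) <= 2 * hs_norm2 A + 2 * hs_norm2 B.
Proof.
rewrite -subr_ge0 (_ : _ - _ = hs_norm2 (A - B)); first exact: hs_norm2_ge0.
rewrite !hs_norm2E !mulr_sumr -big_split -sumrB /=; apply: eq_bigr => i _.
rewrite !mulr_sumr -big_split -sumrB /=; apply: eq_bigr => j _.
by rewrite !mxE; ring.
Qed.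

Lemma hs_norm2_orthogonal m n (U : 'M[R]_m) (A : 'M[R]_(m, n)) :
  U *m U^T = 1%:M -> hs_norm2 (U *m A) = hs_norm2 A.
Proof.
move=> /mulmx1C UU; rewrite /hs_norm2 trmx_mul mxtrace_mulC !mulmxA -(mulmxA _ U^T) UU mulmx1.
exact: mxtrace_mulC.
Qed.

(** U is the normalised character table of the group of subsets of a set with 2k
    elements, a Hadamard matrix; the even exponent makes sqrt (2^(2k)) rational. *)
Lemma flat_orthogonal_matrix k : exists U : 'M[R]_(2 ^ (2 * k)),
  U *m U^T = 1%:M /\ forall i j, `|U i j| = 2^-1 ^+ k.
Proof.
pose T := ({set 'I_(2 * k)} : finType).
have <- : #|T| = (2 ^ (2 * k))%N.
  by rewrite -cardsT -powersetT card_powerset cardsT card_ord.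
pose s (A : T) (x : 'I_(2 * k)) : R := if x \in A then -1 else 1.
have s2 A x : s A x * s A x = 1 by rewrite /s; case: ifP; rewrite ?mulrNN mulr1.
exists (\matrix_(i < #|T|, j < #|T|)
   (2^-1 ^+ k * \prod_(x in enum_val j) s (enum_val i) x)).
split; last first.
  move=> i j; rewrite mxE normrM normr_prod big1 ?mulr1.
    by rewrite ger0_norm// exprn_ge0// invr_ge0.
  by move=> x _; rewrite /s; case: ifP; rewrite ?normrN normr1.
have pow2 : 2^-1 ^+ (2 * k) = 2^-1 ^+ k * 2^-1 ^+ k :> R by rewrite mul2n -addnn exprD.
apply/matrixP => i j; rewrite !mxE.
rewrite (eq_bigr (fun l : 'I_#|T| => 2^-1 ^+ (2 * k) *
    \prod_x (if x \in enum_val l then s (enum_val i) x * s (enum_val j) x else 1))); last first.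
  by move=> l _; rewrite !mxE -big_mkcond big_split /= pow2 mulrACA.
rewrite -mulr_sumr.
rewrite -(big_enum_val (A := T) (fun B : T => \prod_x (if x \in B then s (enum_val i) x * s (enum_val j) x else 1))).
rewrite -(bigA_distr _ _ (fun x => s (enum_val i) x * s (enum_val j) x) (fun=> 1)) /=.
have [<-|ij] := eqVneq i j.
  rewrite (eq_bigr (fun=> 2)) => [|x _]; last by rewrite s2.
  by rewrite prodr_const card_ord -exprMn mulVf// expr1n.
have [x xij] : exists x, (x \in enum_val i) != (x \in enum_val j).
  apply/existsP; apply: contraNT ij; rewrite negb_exists => /forallP eqij.
  by apply/eqP/enum_val_inj/setP => x; have := eqij x; rewrite negbK => /eqP.
rewrite (bigD1 x)//= (_ : s _ x * s _ x + 1 = 0) ?mul0r ?mulr0// /s.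
by move: xij; case: (x \in enum_val i); case: (x \in enum_val j) => // _;
  rewrite ?mulr1 ?mul1r addNr.
Qed.

(** Uncertainty principle: let p be the part of b on A1, and q the image under U^-1
    of the part of b U on A2. The projections b |-> p and b |-> q are almost
    orthogonal, because the scalar product of p and q involves only M x M small
    entries of U; so they cannot both almost fix b. *)
Lemma uncertainty n (U : 'M[R]_n) (t : R) (M : nat) (b : 'rV[R]_n) (A1 A2 : {pred 'I_n}) :
  0 <= t -> U *m U^T = 1%:M -> (forall i j, `|U i j| <= t) -> M%:R * t <= 2^-1 ->
  (#|A1| <= M)%N -> (#|A2| <= M)%N ->
  \sum_(i in A1) b 0 i ^+ 2 + \sum_(j in A2) (b *m U) 0 j ^+ 2 <=
  3 / 2 * \sum_i b 0 i ^+ 2.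
Proof.
move=> t0 UU Ut Mt A1M A2M; set c := b *m U.
set s1 := \sum_(i in A1) _; set s2 := \sum_(j in A2) _; set B := \sum_i _.
pose p i := if i \in A1 then b 0 i else 0.
pose q' : 'rV[R]_n := \row_j (if j \in A2 then c 0 j else 0).
pose q := q' *m U^T.
have s10 : 0 <= s1 by apply: sumr_ge0 => i _; exact: sqr_ge0.
have s20 : 0 <= s2 by apply: sumr_ge0 => i _; exact: sqr_ge0.
have bp : \sum_i b 0 i * p i = s1.
  by rewrite /s1 [RHS]big_mkcond; apply: eq_bigr => i _; rewrite /p; case: ifP; rewrite ?mulr0.
have pp : \sum_i p i ^+ 2 = s1.
  by rewrite /s1 [RHS]big_mkcond; apply: eq_bigr => i _; rewrite /p; case: ifP; rewrite ?expr0n.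
have qE i : q 0 i = \sum_(j in A2) c 0 j * U i j.
  by rewrite mxE [RHS]big_mkcond; apply: eq_bigr => j _; rewrite !mxE; case: ifP; rewrite ?mul0r.
have bq : \sum_i b 0 i * q 0 i = s2.
  under eq_bigr => i _ do rewrite qE mulr_sumr.
  rewrite exchange_big; apply: eq_bigr => j _; rewrite expr2 {2}/c mxE mulr_sumr.
  by apply: eq_bigr => i _; rewrite mulrCA mulrA.
have qq : \sum_i q 0 i ^+ 2 = s2.
  have q'2 : \sum_j q' 0 j ^+ 2 = s2.
    by rewrite /s2 [RHS]big_mkcond; apply: eq_bigr => j _; rewrite mxE; case: ifP; rewrite ?expr0n.
  have := hs_norm2E q; rewrite big_ord1 => <-.
  rewrite /hs_norm2 /q trmx_mul trmxK mulmxA -(mulmxA q') (mulmx1C UU) mulmx1.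
  by have := hs_norm2E q'; rewrite big_ord1 q'2.
have pq : \sum_i p i * q 0 i <= 4^-1 * (s1 + s2).
  rewrite (_ : \sum_i _ = \sum_(i in A1) \sum_(j in A2) b 0 i * (c 0 j * U i j)); last first.
    rewrite [RHS]big_mkcond; apply: eq_bigr => i _; rewrite /p qE; case: ifP; rewrite ?mul0r//.
    by rewrite mulr_sumr.
  apply: (@le_trans _ _ (\sum_(i in A1) \sum_(j in A2) t / 2 * (b 0 i ^+ 2 + c 0 j ^+ 2))).
    apply: ler_sum => i _; apply: ler_sum => j _.
    apply: (le_trans (ler_norm _)); rewrite !normrM mulrA mulrC.
    apply: (@le_trans _ _ (t * (`|b 0 i| * `|c 0 j|))); first by rewrite ler_wpM2r// mulr_ge0.
    rewrite -mulrA ler_wpM2l// -(real_normK (num_real (b 0 i))) -(real_normK (num_real (c 0 j))).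
    have := sqr_ge0 (`|b 0 i| - `|c 0 j|); lra.
  rewrite (eq_bigr (fun i => t / 2 * (#|A2|%:R * b 0 i ^+ 2 + s2))); last first.
    by move=> i _; rewrite -mulr_sumr big_split /= sumr_const -[_ ^+ 2 *+ _]mulr_natl.
  rewrite -mulr_sumr big_split /= sumr_const -mulr_sumr -/s1 -[s2 *+ _]mulr_natl.
  apply: (@le_trans _ _ (t / 2 * (M%:R * s1 + M%:R * s2))).
    by rewrite ler_wpM2l ?divr_ge0// lerD// ler_wpM2r// ler_nat.
  rewrite -mulrDr mulrA ler_wpM2r ?addr_ge0//; lra.
(* The left-hand side s1 + s2 is the scalar product of b with p + q; expanding the
   square of 3/2 b - p - q is Cauchy-Schwarz with the optimal constant. *)
have : 0 <= \sum_i (3 / 2 * b 0 i - p i - q 0 i) ^+ 2 by apply: sumr_ge0 => i _; exact: sqr_ge0.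
rewrite (eq_bigr (fun i => 9 / 4 * b 0 i ^+ 2 + p i ^+ 2 + q 0 i ^+ 2 +
   (-3) * (b 0 i * p i) + (-3) * (b 0 i * q 0 i) + 2 * (p i * q 0 i))); last first.
  by move=> i _; field.
rewrite !big_split /= -!mulr_sumr pp qq bp bq -/B; lra.
Qed.

End Matrices.

(** * Operators into l_2^n *)

Lemma affine_le_exp2 N : (2 * (4 * (N + 6)).+1 <= 2 ^ (N + 6))%N.
Proof.
elim: N => [//|N IH]; rewrite addSn expnS; apply: leq_trans (leq_mul (leqnn 2) IH).
by lia.
Qed.

Section OperatorNorm.
Context {R : realType} {X : normedModType R}.

Lemma l2norm_ge0 n (v : 'rV[R]_n) : 0 <= l2norm v.
Proof. exact: sqrtr_ge0. Qed.

Lemma l2normZ n (c : R) (v : 'rV[R]_n) : l2norm (c *: v) = `|c| * l2norm v.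
Proof.
rewrite /l2norm -sqrtr_sqr -sqrtrM ?sqr_ge0// mulr_sumr; congr Num.sqrt.
by apply: eq_bigr => i _; rewrite mxE exprMn.
Qed.

Lemma op_norm_le (E : set X) n (T : X -> 'rV[R]_n) (b : R) : E 0 ->
  (forall u, E u -> `|u| <= 1 -> l2norm (T u) <= b) -> op_norm E T <= b.
Proof.
move=> E0 Tb; apply: ge_sup; first by exists (l2norm (T 0)); exists 0 => //=; rewrite normr0.
by move=> _ [u [Eu u1] <-]; exact: Tb.
Qed.

Lemma bounded_linear_has_ubound (E : set X) n (T : X -> 'rV[R]_n) :
  bounded_linear_on E T ->
  has_ubound [set l2norm (T u) | u in E `&` [set u | `|u| <= 1]].
Proof.
move=> [_ [M TM]]; exists `|M| => _ [u [Eu /= u1] <-]; apply: (le_trans (TM _ Eu)).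
apply: (@le_trans _ _ (`|M| * `|u|)); first by rewrite ler_wpM2r// ler_norm.
by rewrite ler_piMr.
Qed.

Lemma op_norm_ge0 (E : set X) n (T : X -> 'rV[R]_n) :
  E 0 -> bounded_linear_on E T -> 0 <= op_norm E T.
Proof.
move=> E0 Tlin; apply: le_trans (l2norm_ge0 (T 0)) _.
apply: ub_le_sup; first exact: bounded_linear_has_ubound.
by exists 0 => //; split => //=; rewrite normr0.
Qed.

Lemma le_op_norm n (S : X -> 'rV[R]_n) u :
  bounded_linear_on setT S -> l2norm (S u) <= op_norm setT S * `|u|.
Proof.
move=> Slin; have [S_add _] := Slin.
have S0 : S 0 = 0 by have := S_add (-1) 0 0 I I; rewrite scaler0 addr0 scaleN1r addNr.
have [->|u0] := eqVneq u 0.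
  by rewrite S0 normr0 mulr0 -(scale0r (0 : 'rV_n)) l2normZ normr0 mul0r.
rewrite -ler_pdivrMr ?normr_gt0//.
have -> : l2norm (S u) / `|u| = l2norm (S (`|u|^-1 *: u)).
  rewrite -[in RHS](addr0 (_ *: u)) S_add// S0 addr0 l2normZ mulrC.
  by rewrite ger0_norm ?invr_ge0.
apply: ub_le_sup; first exact: bounded_linear_has_ubound.
exists (`|u|^-1 *: u) => //; split => //=.
by rewrite normrZ ger0_norm ?invr_ge0// mulVf// normr_eq0.
Qed.

End OperatorNorm.

(** * The fourth moment of a Gaussian variable *)

Section FourthMoment.
Context {R : realType}.
Local Open Scope ereal_scope.
Local Notation mu := (@lebesgue_measure R).

(** The density is a Radon-Nikodym derivative, and such derivatives are unique up to
    null sets. *)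
Lemma ge0_integral_normal_prob (m s : R) (f : measurableTypeR R -> \bar R) :
  measurable_fun setT f -> (forall x, 0 <= f x) ->
  \int[normal_prob m s]_x f x = \int[mu]_x (f x * (normal_pdf m s x)%:E).
Proof.
move=> mf f0; have dom := normal_prob_dominates m s.
rewrite -(Radon_Nikodym_SigmaFinite.change_of_variables dom f0 measurableT mf).
have RN_int := Radon_Nikodym_SigmaFinite.f_integrable dom.
have mpdf : measurable_fun [set: R] (fun x => (normal_pdf m s x)%:E).
  by apply/measurable_EFinP; exact: measurable_normal_pdf.
apply: ae_eq_integral => //.
- by apply: emeasurable_funM => //; exact: measurable_int RN_int.
- exact: emeasurable_funM.
- apply: ae_eqe_mul2l; apply: integral_ae_eq => // A _ mA.
  by rewrite -(Radon_Nikodym_SigmaFinite.f_integral dom).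
Qed.

(** Since x^4 exp (- 3 x^2 / 8) is bounded, x^4 times the density with standard
    deviation 1 is dominated by a multiple of the density with standard deviation 2. *)
Lemma normal_fourth_moment : exists2 c4 : R, (0 <= c4)%R &
  \int[normal_prob 0 1]_x ((x : R) ^+ 4)%:E <= c4%:E.
Proof.
pose c4 : R := (32 * (normal_peak 1 / normal_peak 2))%R.
have p1 : (0 < normal_peak 1 :> R)%R by rewrite normal_peak_gt0 ?oner_eq0.
have p2 : (0 < normal_peak 2 :> R)%R by rewrite normal_peak_gt0.
have c40 : (0 <= c4)%R by rewrite mulr_ge0 ?divr_ge0 ?(ltW p1) ?(ltW p2).
exists c4 => //.
have mx4 : measurable_fun [set: R] (fun x : R => (x ^+ 4)%:E).
  by apply/measurable_EFinP; exact: exprn_measurable.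
have x40 (x : R) : (0 <= x ^+ 4)%R by rewrite exprn_even_ge0.
rewrite ge0_integral_normal_prob//.
have mpdf s : measurable_fun [set: R] (fun x => (normal_pdf 0 s x)%:E).
  by apply/measurable_EFinP; exact: measurable_normal_pdf.
apply: (@le_trans _ _ (\int[mu]_x (c4%:E * (normal_pdf 0 2 x)%:E))).
  apply: ge0_le_integral => //.
  - by move=> x _; rewrite -EFinM lee_fin mulr_ge0// normal_pdf_ge0.
  - by apply: emeasurable_funM; [exact: mx4|exact: mpdf].
  - by apply: emeasurable_funM; [exact: measurable_cst|exact: mpdf].
  - move=> x _; rewrite -!EFinM lee_fin !normal_pdfE ?oner_eq0// /normal_fun.
    rewrite subr0 expr1n.
    have -> : (- x ^+ 2 / (1 *+ 2) = - x ^+ 2 / (2 ^+ 2 *+ 2) - 2 * (3 / 16 * x ^+ 2) :> R)%R.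
      by field.
    rewrite expRD expRN expRM_natl; set e := expR (3 / 16 * x ^+ 2); set A := expR _.
    have e0 : (0 < e)%R by exact: expR_gt0.
    have xe : (x ^+ 4 <= 32 * e ^+ 2)%R.
      have xe2 : (3 / 16 * x ^+ 2 <= e)%R.
        by apply: le_trans (expR_ge1Dx _); rewrite lerDr.
      have x20 : (0 <= 3 / 16 * x ^+ 2)%R by rewrite mulr_ge0 ?sqr_ge0.
      have := ler_pM x20 x20 xe2 xe2; have := sqr_ge0 e; lra.
    rewrite [leRHS](_ : _ = 32 * e ^+ 2 * (normal_peak 1 * (A / e ^+ 2)))%R.
      by rewrite ler_wpM2r// mulr_ge0 ?(ltW p1)// divr_ge0 ?sqr_ge0// expR_ge0.
    by rewrite /c4; field; rewrite !gt_eqF.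
rewrite ge0_integralZl//.
- by rewrite integral_normal_pdf mule1.
- exact: mpdf.
- by move=> x _; rewrite lee_fin normal_pdf_ge0.
Qed.

(** The normal law lives on the Borel sets presented as a generated sigma-algebra, the
    law of g_j on R itself; the identity, as a random variable X, transports the
    former to the latter. *)
Lemma gaussian_fourth_moment d (Omega : measurableType d) (P : probability Omega R)
    (g : nat -> {RV P >-> R}) j : standard_gaussian_sequence g ->
  \int[P]_t ((g j t) ^+ 4)%:E = \int[normal_prob 0 1]_x (x ^+ 4)%:E.
Proof.
move=> [_ gauss]; pose N : probability (measurableTypeR R) R := normal_prob 0 1.
pose idR : measurableTypeR R -> R := idfun.
have midR : measurable_fun setT idR by exact: measurable_id.
pose X : {RV N >-> R} := HB.pack idR (isMeasurableFun.Build _ _ _ _ _ midR).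
have mx4 : measurable_fun [set: R] (fun x : R => (x ^+ 4)%:E).
  by apply/measurable_EFinP; exact: exprn_measurable.
have x40 (x : R) : 0 <= (x ^+ 4)%:E by rewrite lee_fin exprn_even_ge0.
transitivity (\int[distribution P (g j)]_x (x ^+ 4)%:E).
  by rewrite ge0_integral_distribution.
transitivity (\int[distribution N X]_x (x ^+ 4)%:E).
  by apply: eq_measure_integral => A mA _; exact: gauss.
by rewrite ge0_integral_distribution.
Qed.

(** The integral of a nonnegative function, measurable or not, is the supremum of the
    integrals of the simple functions below it. *)
Lemma ge0_le_integral_nnsfun d (T : measurableType d) (m : {measure set T -> \bar R})
    (f1 f2 : T -> \bar R) : (forall x, 0 <= f1 x) -> (forall x, f1 x <= f2 x) ->
  \int[m]_x f1 x <= \int[m]_x f2 x.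
Proof.
move=> f10 f12; have f20 x : 0 <= f2 x by exact: le_trans (f12 x).
rewrite !ge0_integralTE//; apply: ge_ereal_sup => _ [h /= hf1 <-].
by apply: ereal_sup_ubound; exists h => // x; exact: le_trans (f12 x).
Qed.

End FourthMoment.

(** * The four properties in S(T^2) *)

Definition unit_seq {R : realType} (i : nat) : nat -> R := fun m => (m == i)%:R.

Lemma unit_seq_supported {R : realType} n i : (i < n)%N ->
  supported_below n (unit_seq i : nat -> R).
Proof. by move=> iN m nm; rewrite /unit_seq gtn_eqF// (leq_trans iN). Qed.

Lemma sum_unit_seq {R : realType} (b : nat -> R) n m :
  \sum_(i < n) b i * unit_seq i m = if (m < n)%N then b m else 0.
Proof.
case: ifPn => mn.
  rewrite (bigD1 (Ordinal mn))//= /unit_seq eqxx mulr1 big1 ?addr0// => i im.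
  by rewrite (_ : m == i = false) ?mulr0//; apply: contraNF im => /eqP mi; exact/eqP/val_inj.
rewrite big1 // => i _; rewrite /unit_seq (_ : m == i = false) ?mulr0//.
by apply: contraNF mn => /eqP ->.
Qed.

Section SymmetricSpace.
Context {R : realType} {X : completeNormedModType R} {coef : X -> nat -> R}.
Context (hX : is_symmetric_T2 coef) {K : R} (K1 : 1 <= K).
Context (normK : forall v : X,
  ((K^-1 * `|v|)%:E <= T2norm (Drearr (coef v)))%E /\
  (T2norm (Drearr (coef v)) <= (K * `|v|)%:E)%E).
Implicit Types (u v : X) (x y : nat -> R).

Let K0 : 0 < K. Proof. exact: lt_le_trans K1. Qed.

Lemma coefZD (a : R) u v n : coef (a *: u + v) n = a * coef u n + coef v n.
Proof. by case: hX. Qed.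

Lemma coef0 n : coef 0 n = 0.
Proof. by have := coefZD (-1) 0 0 n; rewrite scaler0 addr0 mulN1r addNr. Qed.

Lemma coefZ (a : R) u n : coef (a *: u) n = a * coef u n.
Proof. by have := coefZD a u 0 n; rewrite addr0 coef0 addr0. Qed.

Lemma coefD u v n : coef (u + v) n = coef u n + coef v n.
Proof. by have := coefZD 1 u v n; rewrite scale1r mul1r. Qed.

Lemma coef_sum (I : Type) (r : seq I) (P : pred I) (F : I -> X) n :
  coef (\sum_(i <- r | P i) F i) n = \sum_(i <- r | P i) coef (F i) n.
Proof.
elim/big_rec2: _ => [|i y x _ <-]; [exact: coef0|exact: coefD].
Qed.

Lemma finitely_supported_symT2 L x : supported_below L x -> symT2 x.
Proof.
move=> xL; split; first by apply: cvg_near_cst; exists L => // n /xL.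
exact: le_lt_trans (T2norm_Drearr_le_l2 xL) (ltry _).
Qed.

Definition vec x : X := xget 0 [set v | coef v = x].

Lemma vecK L x : supported_below L x -> coef (vec x) = x.
Proof.
move=> /finitely_supported_symT2 xS.
have : range coef x by case: hX => _ _ -> _.
by move=> [v _ vx]; apply: (@xgetPex _ 0 [set v | coef v = x]); exists v.
Qed.

Lemma norm_le v (b : R) : (T2norm (Drearr (coef v)) <= b%:E)%E -> `|v| <= K * b.
Proof.
have [lo _] := normK v => /(le_trans lo); rewrite lee_fin.
by rewrite ler_pdivrMl.
Qed.

Lemma norm_ge v (b : R) : (b%:E <= T2norm (Drearr (coef v)))%E -> b / K <= `|v|.
Proof.
have [_ up] := normK v => /le_trans/(_ up); rewrite lee_fin.
by rewrite ler_pdivrMr// mulrC.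
Qed.

Lemma norm_dominated L1 L2 u v (phi : nat -> nat) :
  supported_below L1 (coef u) -> supported_below L2 (coef v) ->
  {in [pred m | coef u m != 0] &, injective phi} ->
  (forall m, `|coef u m| <= `|coef v (phi m)|) ->
  `|u| <= K ^+ 2 * `|v|.
Proof.
move=> uL vL phi_inj uv; rewrite expr2 -mulrA; apply: norm_le.
by have [_] := normK v; apply: le_trans; exact: T2norm_Drearr_mono uL vL phi_inj uv.
Qed.

Lemma norm_le_l2 L v : supported_below L (coef v) ->
  `|v| <= K * Num.sqrt (\sum_(0 <= m < L) sqr_seq (coef v) m).
Proof. by move=> vL; apply/norm_le/T2norm_Drearr_le_l2. Qed.

(** By disjointness a change of signs does not alter the moduli of the terms of a
    combination of the x i. *)
Lemma disjoint_unconditional L n (x : 'I_n -> X) :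
  normalized x -> disjointly_supported coef x ->
  (forall i, supported_below L (coef (x i))) -> unconditional_basic (K ^+ 2) x.
Proof.
move=> x1 xdisj xL.
have one_term (b : 'I_n -> R) i m : coef (x i) m != 0 ->
    coef (\sum_j b j *: x j) m = b i * coef (x i) m.
  move=> xim; rewrite coef_sum (bigD1 i)//= coefZ big1 ?addr0// => j ji.
  rewrite coefZ; case: (xdisj _ _ ji m) => [->|xi]; first by rewrite mulr0.
  by rewrite xi eqxx in xim.
have no_term (b : 'I_n -> R) m : (forall i, coef (x i) m = 0) ->
    coef (\sum_j b j *: x j) m = 0.
  by move=> xm; rewrite coef_sum big1// => j _; rewrite coefZ xm mulr0.
have sumL (b : 'I_n -> R) : supported_below L (coef (\sum_j b j *: x j)).
  by move=> m Lm; apply: no_term => i; exact: xL.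
split=> [b b0 i|b e].
  have [[m xim]|noc] := pselect (exists m, coef (x i) m != 0).
    have := one_term b i m xim; rewrite b0 coef0 => /esym/eqP.
    by rewrite mulf_eq0 (negbTE xim) orbF => /eqP.
  have /eqP := x1 i; rewrite (_ : x i = 0) ?normr0 ?(eq_sym 0) ?oner_eq0//.
  case: hX => _ coef_inj _ _; apply: coef_inj; apply/funext => m; rewrite coef0.
  by apply/eqP; apply: contraT => xim; case: noc; exists m.
apply: (norm_dominated (phi := id) (sumL _) (sumL _)) => // m.
have [[i xim]|noc] := pselect (exists i, coef (x i) m != 0).
  by rewrite !(one_term _ i)// -mulrA normrM normrX normrN1 expr1n mul1r.
have xm i : coef (x i) m = 0 by apply/eqP; apply: contraT => xim; case: noc; exists i.
by rewrite !no_term.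
Qed.

Definition copy N (a : nat -> R) (i : nat) : X := vec (copies N (unit_seq i) a).

Lemma copyE N a i : (0 < N)%N -> coef (copy N a i) = copies N (unit_seq i) a.
Proof.
by move=> N0; apply/vecK/copies_supported => //; exact: (unit_seq_supported (ltnSn i)).
Qed.

Lemma coef_sum_copy N a n (b : nat -> R) : (0 < N)%N ->
  coef (\sum_(i < n) b i *: copy N a i) =
  copies N (fun q => if (q < n)%N then b q else 0) a.
Proof.
move=> N0; apply/funext => m; rewrite coef_sum /copies -sum_unit_seq mulr_suml.
by apply: eq_bigr => i _; rewrite coefZ copyE// /copies mulrA.
Qed.

Lemma copy_norm_le N a i (eps : R) : (0 < N)%N -> supported_below N a ->
  (T2norm (Drearr a) <= eps%:E)%E -> `|copy N a i| <= K * eps.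
Proof.
move=> N0 aN aeps; apply: norm_le; apply: le_trans aeps; rewrite copyE//.
apply: (@T2norm_Drearr_mono _ (i.+1 * N) N _ _ (fun m => m %% N)%N) => //.
- by apply: copies_supported => //; exact: (unit_seq_supported (ltnSn i)).
- have qi m : copies N (unit_seq i) a m != 0 -> (m %/ N = i)%N.
    by rewrite /copies /unit_seq; have [//|_] := eqVneq (m %/ N)%N i; rewrite mul0r eqxx.
  move=> m m'; rewrite !inE => /qi mi /qi m'i mm'.
  by rewrite (divn_eq m N) (divn_eq m' N) mi m'i mm'.
- move=> m; rewrite /copies normrM ler_piMl// /unit_seq.
  by case: (_ == _); rewrite ?normr1 ?normr0.
Qed.

Lemma copy_norm_gt0 N a i : (0 < N)%N -> 0 < a 0 -> 0 < `|copy N a i|.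
Proof.
move=> N0 a0; rewrite normr_gt0; apply/eqP => c0.
have : coef (copy N a i) (i * N)%N = a 0%N.
  by rewrite copyE// /copies mulnK// modnMl /unit_seq eqxx mul1r.
by rewrite c0 coef0 => /esym a00; rewrite a00 ltxx in a0.
Qed.

(** The n vectors are the normalised disjoint copies of a; each copy has norm at most
    K eps, so the sum dominates (K eps)^-1 1_n (x) a, whose norm is controlled from
    below by [T2norm_copies_ge]. *)
Lemma disjoint_blowup (B : R) : exists n (x : 'I_n -> X), [/\ normalized x,
  disjointly_supported coef x, exists L, forall i, supported_below L (coef (x i)) &
  B * Num.sqrt n%:R < `|\sum_i x i|].
Proof.
pose eps := (4 * K ^+ 2 * (`|B| + 1))^-1.
have eps0 : 0 < eps by rewrite invr_gt0 !mulr_gt0 ?exprn_gt0// ltr_wpDl.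
have [a [N [N0 aN adec [a0 a1] aeps]]] := small_T2norm eps0.
have Daeps := le_trans (T2norm_Drearr_decreasing aN adec) aeps.
(* With M = N + 1 any M of the n = 2M equal weights carry half of the mass, and
   n N <= M 2^M. *)
pose n := (2 * N.+1)%N; pose x (i : 'I_n) := `|copy N a i|^-1 *: copy N a i.
have copy0 i := copy_norm_gt0 i N0 a0.
have xS : \sum_i x i = \sum_(i < n) `|copy N a i|^-1 *: copy N a i by [].
exists n, x; split.
- by move=> i; rewrite normrZ ger0_norm ?invr_ge0// mulVf// gt_eqF.
- move=> i j ij m; rewrite !coefZ !copyE// /copies /unit_seq.
  have [mi|_] := eqVneq (m %/ N)%N i; last by left; rewrite mul0r mulr0.
  by right; rewrite mi (_ : _ == _ = false) ?mul0r ?mulr0//; exact: negbTE.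
- exists (n * N)%N => i m nm; rewrite coefZ copyE//.
  by rewrite (copies_supported a N0 (unit_seq_supported (ltn_ord i)))// mulr0.
pose w q := if (q < n)%N then (K * eps)^-1 else 0.
have Keps0 : 0 < (K * eps)^-1 by rewrite invr_gt0 mulr_gt0.
have sum_w (P : pred nat) : \sum_(0 <= q < n | P q) sqr_seq w q =
    (\sum_(0 <= q < n | P q) 1) * (K * eps)^-1 ^+ 2.
  rewrite mulr_suml [LHS]big_nat_cond [RHS]big_nat_cond; apply: eq_bigr => q /andP[/andP[_ qn] _].
  by rewrite /sqr_seq /w qn mul1r.
have wn : supported_below n w by move=> q; rewrite /w ltnNge => ->.
have := @T2norm_copies_ge _ w a n N N.+1 N0 isT.
have nN : (n * N <= N.+1 * 2 ^ N.+1)%N.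
  by rewrite /n mulnAC mulnC leq_mul2l expnS leq_mul2l/= ltnW// ltn_expl.
move=> /(_ nN wn a1) lower.
have {}lower : ((4^-1 * (Num.sqrt n%:R * (K * eps)^-1))%:E <= T2norm (Drearr (copies N w a)))%E.
  rewrite -[X in _ * X](_ : Num.sqrt (\sum_(0 <= q < n) sqr_seq w q) = _); last first.
    by rewrite (sum_w predT) sumr_const_nat subn0 sqrtrM ?ler0n// sqrtr_sqr gtr0_norm.
  apply: lower => A AN; rewrite !sum_w mulrA ler_wpM2r ?sqr_ge0//.
  rewrite sumr_const_nat subn0.
  have : \sum_(0 <= q < n | q \in A) (1 : R) <= N.+1%:R.
    rewrite (eq_bigr (fun=> 1%:R))// -natr_sum ler_nat sum1_count (leq_trans _ AN)// -size_filter.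
    apply: uniq_leq_size; first exact/filter_uniq/iota_uniq.
    by move=> q; rewrite mem_filter => /andP[].
  by move/le_trans; apply; rewrite /n natrM; have := ler0n R N.+1; lra.
have {}lower : 4^-1 * (Num.sqrt n%:R * (K * eps)^-1) / K <= `|\sum_i x i|.
  apply: norm_ge; apply: le_trans lower _; rewrite xS.
  rewrite (coef_sum_copy a n (fun i => `|copy N a i|^-1) N0).
  apply: (T2norm_Drearr_mono (phi := id) (L1 := (n * N)%N) (L2 := (n * N)%N)) => //.
  - exact: copies_supported.
  - by apply: copies_supported => // q; rewrite ltnNge => ->.
  - move=> m; rewrite /copies /w !normrM ler_wpM2r//; case: ifP => // _.
    rewrite (gtr0_norm Keps0) ger0_norm ?invr_ge0// lef_pV2 ?posrE ?copy0 ?mulr_gt0//.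
    exact: copy_norm_le.
apply: lt_le_trans lower.
have sn : 0 < Num.sqrt n%:R :> R by rewrite sqrtr_gt0 ltr0n.
have -> : 4^-1 * (Num.sqrt n%:R * (K * eps)^-1) / K = (`|B| + 1) * Num.sqrt n%:R.
  by rewrite /eps !invfM !invrK; field; rewrite gt_eqF.
by rewrite ltr_pM2r// ltr_pwDr// ler_norm.
Qed.

Lemma not_disjoint_upper_H : ~ disjoint_upper_H coef.
Proof.
move=> [B upper]; have [n [x [x1 xdisj _]]] := disjoint_blowup B.
by rewrite ltNge upper.
Qed.

Lemma not_upper_H : ~ upper_H X.
Proof.
move=> [f upper]; have [n [x [x1 xdisj [L xL]]]] := disjoint_blowup (f (K ^+ 2)).
by rewrite ltNge upper//; exact: disjoint_unconditional xL.
Qed.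

Lemma unit_vec_norm_ge i : K^-1 <= `|vec (unit_seq i)|.
Proof.
rewrite -[leLHS]mul1r; apply: norm_ge; have iL := @unit_seq_supported R _ _ (ltnSn i).
rewrite (vecK iL); apply: le_trans (T2norm_Drearr_ge_term i iL).
by rewrite /unit_seq eqxx normr1.
Qed.

(** Whatever set F of at least half of the 2N unit vectors is chosen, the coefficients
    a, listed along F, give a vector of norm at most K eps, by symmetry. *)
Lemma not_lower_H2 : ~ lower_H2 X.
Proof.
move=> [C lower]; have half : 0 < (2^-1 : R) < 1 by apply/andP; split; lra.
pose c := C (K ^+ 2) 2^-1; pose eps := (K ^+ 2 * (`|c| + 1))^-1.
have eps0 : 0 < eps by rewrite invr_gt0 mulr_gt0 ?exprn_gt0// ltr_wpDl.
have [a [N [N0 aN adec [a0 a1] aeps]]] := small_T2norm eps0.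
have Daeps := le_trans (T2norm_Drearr_decreasing aN adec) aeps.
pose e i := vec (unit_seq i).
have e0 i : 0 < `|e i| by apply: lt_le_trans (unit_vec_norm_ge i); rewrite invr_gt0.
have eE i m : coef (e i) m = (m == i)%:R.
  by rewrite (vecK (unit_seq_supported (ltnSn i))).
pose n := (2 * N)%N; pose x (i : 'I_n) := `|e i|^-1 *: e i.
have x1 : normalized x by move=> i; rewrite normrZ ger0_norm ?invr_ge0// mulVf// gt_eqF.
have xL i : supported_below n (coef (x i)).
  by move=> m nm; rewrite coefZ eE gtn_eqF ?mulr0// (leq_trans (ltn_ord i)).
have xdisj : disjointly_supported coef x.
  move=> i j ij m; rewrite !coefZ !eE; have [mi|_] := eqVneq m i; last by left; rewrite mulr0.
  by right; rewrite mi (_ : _ == _ = false) ?mulr0//; exact: negbTE.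
have [F Fn Flow] := lower _ _ half n x x1 (disjoint_unconditional x1 xdisj xL).
have NF : (N <= #|F|)%N by move: Fn; rewrite /n natrM mulKf// ler_nat.
(* phi numbers the members of F, so that the j-th of them gets the coefficient a j. *)
pose s := map val (enum F); have su : uniq s by rewrite map_inj_uniq ?enum_uniq//; exact: val_inj.
have sF (i : 'I_n) : (val i \in s) = (i \in F) by rewrite mem_map ?mem_enum//; exact: val_inj.
pose phi m := index m s.
have := Flow (fun i => a (phi i) * `|e i|).
set v := \sum_(i in F) (_ *: _).
have vE m : coef v m = if m \in s then a (phi m) else 0.
  rewrite coef_sum (eq_bigr (fun i : 'I_n => a (phi i) * unit_seq i m)); last first.
    by move=> i _; rewrite !coefZ eE mulrA mulfK// gt_eqF.
  rewrite big_mkcond /= (eq_bigr (fun i : 'I_n => (fun q => if q \in s then a (phi q) else 0) i * unit_seq i m)).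
    rewrite (sum_unit_seq (fun q => if q \in s then a (phi q) else 0)); case: ltnP => // nm.
    case: ifP => // /mapP[i _ mi]; by rewrite mi leqNgt ltn_ord in nm.
  by move=> i _; rewrite sF; case: ifP; rewrite ?mul0r.
have vsmall : `|v| <= K * eps.
  apply: norm_le; apply: le_trans Daeps.
  apply: (T2norm_Drearr_mono (phi := phi) (L1 := n) (L2 := N)) => //.
  - move=> m nm; rewrite vE; case: ifP => // /mapP[i _ mi].
    by rewrite mi leqNgt ltn_ord in nm.
  - have mem_s m : coef v m != 0 -> m \in s by rewrite vE; case: ifP => //; rewrite eqxx.
    move=> i j; rewrite !inE => /mem_s si /mem_s sj ij.
    by rewrite -(nth_index 0%N si) -/(phi i) ij nth_index.
  - by move=> m; rewrite vE; case: ifP; rewrite ?normr0.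
have sum_F : \sum_(i in F) a (phi i) ^+ 2 = 1.
  rewrite -big_enum -(big_map val xpredT (fun m => a (phi m) ^+ 2)) -/s (big_nth 0%N).
  have sizes : size s = #|F| by rewrite size_map cardE.
  rewrite (eq_big_nat _ _ (F2 := sqr_seq a)) => [|j /andP[_ js]]; last by rewrite /phi index_uniq.
  rewrite sizes (big_cat_nat _ (n := N))//= a1 big1_seq ?addr0// => j.
  by rewrite mem_index_iota => /andP[_ /andP[Nj _]]; rewrite /sqr_seq aN ?expr0n.
apply/negP; rewrite -ltNge -/c.
apply: (@lt_le_trans _ _ K^-1).
  apply: (@le_lt_trans _ _ (`|c| * (K * eps))).
    apply: (@le_trans _ _ (`|c| * `|v|)); first by rewrite ler_wpM2r// ler_norm.
    by rewrite ler_wpM2l.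
  rewrite [ltLHS](_ : _ = K^-1 * (`|c| / (`|c| + 1))); last first.
    rewrite /eps; field; rewrite (gt_eqF K0)/= gt_eqF// ltr_wpDl//.
  by rewrite gtr_pMr ?invr_gt0// ltr_pdivrMr ?mul1r ?ltrDl// ltr_wpDl.
rewrite -[leLHS]ger0_norm ?invr_ge0 ?(ltW K0)// -sqrtr_sqr ler_wsqrtr//.
rewrite -[leLHS]mulr1 -sum_F mulr_sumr; apply: ler_sum => i _.
rewrite real_normK ?num_real// exprMn mulrC ler_wpM2l ?sqr_ge0//.
by rewrite lerXn2r ?nnegrE ?invr_ge0 ?(ltW K0)//; exact: unit_vec_norm_ge.
Qed.

(** T is the inverse of the embedding of b as the combination of 2n copies of a with
    the coefficients w b = (b, b U). The extension S maps each copy to a vector of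
    norm O(eps), although P is recovered from these 2n images through the isometries
    1 and U. *)
Lemma not_weak_type2 : ~ weak_type2 X.
Proof.
move=> [C [delta [/andP[delta0 delta1] wt2]]].
pose eps := delta / (8 * K ^+ 2 * (`|C| + 1)).
have C1 : 0 < `|C| + 1 by rewrite ltr_wpDl.
have eps0 : 0 < eps by rewrite divr_gt0// !mulr_gt0// exprn_gt0.
have [a [N [N0 aN adec [a0 a1] aeps]]] := small_T2norm eps0.
have Daeps := le_trans (T2norm_Drearr_decreasing aN adec) aeps.
(* n = 4^k: the 2n copies fill 2 n N <= M 2^M = 2 M n^2 positions, and M entries of
   modulus 2^-k satisfy M 2^-k <= 1/2 as soon as k >= 6. *)
pose k := (N + 6)%N; pose M := (4 * k).+1; pose n := (2 ^ (2 * k))%N.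
have Mk : (2 * M <= 2 ^ k)%N by exact: affine_le_exp2.
have N2k : (N <= n)%N by rewrite (leq_trans (ltnW (ltn_expl N (isT : 1 < 2)%N)))// leq_exp2l// /k; lia.
have n0 : (0 < n)%N by rewrite expn_gt0.
have [U [UU Uflat]] := @flat_orthogonal_matrix R k.
pose ext m (w : 'rV[R]_m) q := if insub q is Some i then w 0 i else 0.
have extE m (w : 'rV[R]_m) (i : 'I_m) : ext m w i = w 0 i by rewrite /ext valK.
have ext_lt m (w : 'rV[R]_m) q : (m <= q)%N -> ext m w q = 0.
  by move=> mq; rewrite /ext insubF// ltnNge mq.
pose w (b : 'rV[R]_n) := row_mx b (b *m U).
pose y m (w : 'rV[R]_m) : X := \sum_(i < m) w 0 i *: copy N a i.
have yE m (z : 'rV[R]_m) : coef (y m z) = copies N (ext m z) a.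
  rewrite /y (eq_bigr (fun i : 'I_m => ext m z i *: copy N a i)); last first.
    by move=> i _; rewrite extE.
  rewrite coef_sum_copy//; congr copies; apply/funext => q.
  by case: ltnP => // /(ext_lt m z) ->.
have y_linear m (c : R) (z1 z2 : 'rV[R]_m) : y m (c *: z1 + z2) = c *: y m z1 + y m z2.
  rewrite /y scaler_sumr -big_split; apply: eq_bigr => i _.
  by rewrite !mxE scalerDl scalerA.
have y_lower b : l2norm b <= 4 * K * `|y _ (w b)|.
  pose e := ext _ (w b).
  have sum_e (P : pred nat) : \sum_(0 <= q < n + n | P q) sqr_seq e q =
      \sum_(i in [pred i : 'I_n | P i]) b 0 i ^+ 2 +
      \sum_(j in [pred j : 'I_n | P (n + j)%N]) (b *m U) 0 j ^+ 2.
    rewrite big_mkord big_split_ord /=; congr (_ + _); apply: eq_bigr => i _.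
      by rewrite /sqr_seq /e (extE _ _ (lshift n i)) row_mxEl.
    by rewrite /sqr_seq /e (extE _ _ (rshift n i)) row_mxEr.
  have sum_bU : \sum_j (b *m U) 0 j ^+ 2 = \sum_i b 0 i ^+ 2.
    have := hs_norm2E b; rewrite big_ord1 => <-; have := hs_norm2E (b *m U).
    by rewrite big_ord1 => <-; rewrite /hs_norm2 trmx_mul mulmxA -(mulmxA b) UU mulmx1.
  have sum_all : \sum_(0 <= q < n + n) sqr_seq e q = 2 * \sum_i b 0 i ^+ 2.
    by rewrite (sum_e predT) sum_bU; lra.
  have en : supported_below (n + n) e by exact: ext_lt.
  have nM : ((n + n) * N <= M * 2 ^ M)%N.
    have -> : (2 ^ M = (n + n) * n)%N.
      by rewrite addnn -mul2n -mulnA -expnD -expnS; congr (2 ^ _)%N; rewrite /M; lia.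
    rewrite mulnCA leq_mul2l (leq_trans N2k) ?orbT// leq_pmull//.
  have := @T2norm_copies_ge _ e a (n + n) N M N0 isT nM en a1.
  rewrite sum_all => lower.
  have {}lower : ((4^-1 * Num.sqrt (2 * \sum_i b 0 i ^+ 2))%:E <= T2norm (Drearr (copies N e a)))%E.
    apply: lower => A AM; rewrite sum_e.
    have card_le (f : 'I_n -> nat) : injective f -> (#|[pred i | f i \in A]| <= M)%N.
      move=> f_inj; rewrite cardE -(size_map f) (leq_trans _ AM)//.
      apply: uniq_leq_size; first by rewrite map_inj_uniq ?enum_uniq.
      by move=> _ /mapP[i + ->]; rewrite mem_enum.
    apply: (@le_trans _ _ (3 / 2 * \sum_i b 0 i ^+ 2)); last by rewrite mulrA; lra.
    apply: (@uncertainty _ _ U (2^-1 ^+ k) M) => //.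
    - by move=> i j; rewrite Uflat.
    - rewrite exprVn ler_pdivrMr ?exprn_gt0// -(ler_pM2l (ltr0n R 2)) mulrA divff// mul1r.
      by rewrite -natrX -natrM ler_nat.
    - exact/card_le/val_inj.
    - by apply: card_le => i j /addnI/val_inj.
  have := norm_ge (v := y _ (w b)) (b := 4^-1 * Num.sqrt (2 * \sum_i b 0 i ^+ 2)).
  rewrite yE => /(_ lower); rewrite ler_pdivrMr// => {}lower.
  have : l2norm b <= Num.sqrt (2 * \sum_i b 0 i ^+ 2).
    have B0 : 0 <= \sum_i b 0 i ^+ 2 by apply: sumr_ge0 => i _; exact: sqr_ge0.
    by rewrite /l2norm ler_sqrt ?mulr_ge0//; lra.
  by move/le_trans; apply; rewrite -mulrA (mulrC K); lra.
pose E := [set u | exists b, u = y _ (w b)].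
have w_linear (c : R) b1 b2 : w (c *: b1 + b2) = c *: w b1 + w b2.
  by rewrite /w mulmxDl -scalemxAl scale_row_mx add_row_mx.
have y0 m : y m 0 = 0 by rewrite /y big1// => i _; rewrite mxE scale0r.
have w0 : w 0 = 0 by rewrite /w mul0mx row_mx0.
(* The first place of the i-th copy, for i < n, carries b i * a 0. *)
pose T (u : X) : 'rV[R]_n := \row_i (coef u (i * N)%N / a 0%N).
have Ty b : T (y _ (w b)) = b.
  apply/rowP => i; rewrite mxE yE /copies mulnK// modnMl mulfK ?gt_eqF//.
  by rewrite (extE _ _ (lshift n i)) row_mxEl.
have subE : linear_subspace E.
  split; first by exists 0; rewrite w0 y0.
  by move=> c _ _ [b1 ->] [b2 ->]; exists (c *: b1 + b2); rewrite w_linear y_linear.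
have T_bounded u : E u -> l2norm (T u) <= 4 * K * `|u|.
  by move=> [b ->]; rewrite Ty.
have T_lin : bounded_linear_on E T.
  split; last by exists (4 * K).
  by move=> c u v _ _; apply/rowP => i; rewrite !mxE coefZD mulrDl mulrA.
have [P [S [[PP PT] rankP S_lin SE S_norm]]] := wt2 E n T n0 subE T_lin.
have T_norm : op_norm E T <= 4 * K.
  apply: op_norm_le => [|u Eu u1]; first by case: subE.
  by apply: le_trans (T_bounded _ Eu) _; rewrite ler_piMr// mulr_ge0// ltW.
have K4 : 0 <= 4 * K by rewrite mulr_ge0// ltW.
have {}S_norm : op_norm setT S <= `|C| * (4 * K).
  apply: (le_trans S_norm); apply: (@le_trans _ _ (`|C| * op_norm E T)).
    by rewrite ler_wpM2r ?ler_norm//; exact: op_norm_ge0 (proj1 subE) T_lin.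
  by rewrite ler_wpM2l.
(* eps was chosen to give |C| (4 K) (K eps) <= delta / 2 here. *)
have S_copy q : l2norm (S (copy N a q)) <= delta / 2.
  apply: (le_trans (le_op_norm _ S_lin)).
  apply: (@le_trans _ _ (`|C| * (4 * K) * (K * eps))).
    by rewrite ler_pM//; [exact: op_norm_ge0 S_lin|exact: copy_norm_le].
  rewrite [leLHS](_ : _ = delta / 2 * (`|C| / (`|C| + 1))).
    by rewrite ler_piMr ?divr_ge0 ?(ltW delta0)// ler_pdivrMr// mul1r lerDl.
  by rewrite /eps; field; rewrite !gt_eqF.
pose A := \matrix_(i < n, l < n) S (copy N a i) 0 l.
pose B := \matrix_(j < n, l < n) S (copy N a (n + j)%N) 0 l.
have S_hs (f : 'I_n -> nat) : hs_norm2 (\matrix_(i < n, l < n) S (copy N a (f i)) 0 l) <= n%:R * (delta / 2) ^+ 2.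
  rewrite hs_norm2E -[leRHS](_ : \sum_(i < n) (delta / 2) ^+ 2 = _); last first.
    by rewrite sumr_const card_ord mulr_natl.
  apply: ler_sum => i _; have := S_copy (f i).
  rewrite -(ler_sqr (sqrtr_ge0 _)) ?nnegrE ?divr_ge0 ?(ltW delta0)// => /(le_trans _); apply.
  rewrite sqr_sqrtr; last by apply: sumr_ge0 => l _; exact: sqr_ge0.
  by rewrite le_eqVlt (eq_bigr (fun l => S (copy N a (f i)) 0 l ^+ 2)) ?eqxx// => l _; rewrite mxE.
have S_sum m (v : 'rV[R]_m) : S (y m v) = \sum_i v 0 i *: S (copy N a i).
  have [S_add _] := S_lin.
  have S0 : S 0 = 0.
    by have := S_add (-1) 0 0 I I; rewrite scaler0 addr0 scaleN1r addNr.
  rewrite /y; elim/big_rec2: _ => [//|i u1 u2 _ <-].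
  by rewrite S_add.
(* S applied to the embedding of the i-th basis vector. *)
have PE : P = A + U *m B.
  apply/row_matrixP => i; have Ei : E (y _ (w (delta_mx 0 i))) by exists (delta_mx 0 i).
  have := SE _ Ei; rewrite Ty -rowE => <-.
  rewrite S_sum big_split_ord /=; apply/rowP => l.
  rewrite [LHS]mxE !summxE [RHS]mxE [RHS]mxE; congr (_ + _).
    rewrite (bigD1 i)//= mxE row_mxEl [delta_mx _ _ _ _]mxE !eqxx mul1r [RHS]mxE big1 ?addr0// => j ji.
    by rewrite mxE row_mxEl [delta_mx _ _ _ _]mxE eqxx (negbTE ji) mul0r.
  rewrite mxE; apply: eq_bigr => j _; rewrite mxE row_mxEr -rowE; congr (_ * _).
    by rewrite mxE.
  by rewrite mxE.
have : delta * n%:R < n%:R * delta ^+ 2.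
  apply: (lt_le_trans rankP).
  rewrite -(mxtrace_idempotent PP) -[X in \tr X]PP -[X in _ *m X]PT -/(hs_norm2 P) PE.
  apply: (le_trans (hs_norm2D _ _)); rewrite (hs_norm2_orthogonal _ UU).
  have := S_hs val; rewrite -/A; have := S_hs (fun j => n + j)%N; rewrite -/B.
  set h := n%:R; lra.
apply/negP; rewrite -leNgt mulrC ler_wpM2r// expr2 ler_piMr ?(ltW delta1)//.
exact: ltW.
Qed.

Lemma coef_sum_unit n (b : nat -> R) m :
  coef (\sum_(j < n) b j *: vec (unit_seq j)) m = if (m < n)%N then b m else 0.
Proof.
rewrite coef_sum -sum_unit_seq; apply: eq_bigr => j _.
by rewrite coefZ (vecK (unit_seq_supported (ltnSn j))).
Qed.

(** The terms with |z j| <= L are dominated by L a, of norm L eps; the others are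
    estimated in l_2, using z^2 <= z^4 / L^2 there. *)
Lemma multiplier_norm_le N (a z : nat -> R) (eps L : R) :
  supported_below N a -> (T2norm (Drearr a) <= eps%:E)%E -> 0 <= eps -> 0 < L ->
  `|\sum_(j < N) (z j * a j) *: vec (unit_seq j)| ^+ 2 <=
  2 * (K ^+ 3 * L * eps) ^+ 2 +
  2 * (K / L) ^+ 2 * \sum_(0 <= j < N) sqr_seq a j * z j ^+ 4.
Proof.
move=> aN aeps eps0 L0.
pose comb (b : nat -> R) := \sum_(j < N) b j *: vec (unit_seq j).
have combL b : supported_below N (coef (comb b)).
  by move=> m Nm; rewrite coef_sum_unit ltnNge Nm.
pose low j := if `|z j| <= L then z j * a j else 0.
pose high j := if `|z j| <= L then 0 else z j * a j.
have split_sum : \sum_(j < N) (z j * a j) *: vec (unit_seq j) = comb low + comb high.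
  rewrite -big_split /=; apply: eq_bigr => j _; rewrite -scalerDl; congr (_ *: _).
  by rewrite /low /high; case: ifP; rewrite ?addr0 ?add0r.
have low_le : `|comb low| <= K ^+ 3 * L * eps.
  have aE : coef (comb a) = a.
    by apply/funext => m; rewrite coef_sum_unit; case: ltnP => // /aN ->.
  have La : `|comb low| <= K ^+ 2 * `|L *: comb a|.
    apply: (norm_dominated (phi := id) (combL _) (L2 := N)) => // m.
      by move=> Nm; rewrite coefZ combL ?mulr0.
    rewrite coefZ aE coef_sum_unit /low; case: ifP => _; last by rewrite normr0.
    case: ifP => [zL|_]; last by rewrite normr0.
    by rewrite !normrM ler_wpM2r// (gtr0_norm L0).
  apply: (le_trans La); rewrite normrZ (gtr0_norm L0).
  have : `|comb a| <= K * eps by apply: norm_le; rewrite aE.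
  move=> ca; rewrite (_ : K ^+ 3 * L * eps = K ^+ 2 * (L * (K * eps))); last by ring.
  by rewrite ler_wpM2l ?sqr_ge0// ler_wpM2l// ltW.
have high_le : `|comb high| ^+ 2 <= (K / L) ^+ 2 * \sum_(0 <= j < N) sqr_seq a j * z j ^+ 4.
  have S0 : 0 <= \sum_(0 <= m < N) sqr_seq (coef (comb high)) m.
    by apply: sumr_ge0 => m _; exact: sqr_seq_ge0.
  apply: (@le_trans _ _ (K ^+ 2 * \sum_(0 <= m < N) sqr_seq (coef (comb high)) m)).
    rewrite -[X in _ <= _ * X](sqr_sqrtr S0) -exprMn.
    by rewrite lerXn2r ?nnegrE ?mulr_ge0 ?sqrtr_ge0 ?(ltW K0)//; exact: norm_le_l2.
  rewrite exprMn -[leRHS]mulrA ler_wpM2l ?sqr_ge0// mulr_sumr; apply: ler_sum_nat => m /andP[_ mN].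
  rewrite /sqr_seq coef_sum_unit mN /high; case: ifPn => [_|].
    by rewrite expr0n mulr_ge0 ?sqr_ge0// mulr_ge0 ?sqr_ge0// exprn_even_ge0.
  rewrite -ltNge => Lz; rewrite exprMn exprVn [leRHS]mulrCA [leLHS]mulrC ler_wpM2l ?sqr_ge0//.
  rewrite [leRHS]mulrC ler_pdivlMr ?exprn_gt0// (exprD _ 2 2) ler_wpM2l ?sqr_ge0//.
  by rewrite -(real_normK (num_real (z m))) lerXn2r ?nnegrE// ltW.
rewrite split_sum; apply: (@le_trans _ _ ((`|comb low| + `|comb high|) ^+ 2)).
  by rewrite lerXn2r ?nnegrE ?addr_ge0// ler_normD.
have low2 : `|comb low| ^+ 2 <= (K ^+ 3 * L * eps) ^+ 2.
  by rewrite lerXn2r ?nnegrE ?mulr_ge0 ?exprn_ge0// ltW.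
have := sqr_ge0 (`|comb low| - `|comb high|).
by move: low2 high_le; set h := \sum_(0 <= j < N) _; set x := `|comb low|; set y := `|comb high|; lra.
Qed.

(** For x_j = a_j e_j the left-hand side is at least 1/K, whereas the Gaussian average
    is made arbitrarily small by [multiplier_norm_le]: L is chosen from the fourth
    moment c4, and then eps from L, so that D^2 times the bound A1 + A2 c4 on the
    average stays below 1/K^2. *)
Lemma not_cotype2 d (Omega : measurableType d) (P : probability Omega R)
  (g : nat -> {RV P >-> R}) : standard_gaussian_sequence g -> ~ cotype2 g X.
Proof.
move=> gauss [B cot]; have [c4 c40 fourth] := @normal_fourth_moment R.
pose D := `|B| + 1; have D0 : 0 < D by rewrite ltr_wpDl.
pose L := 2 * K ^+ 2 * D * (c4 + 1).
have c41 : 0 < c4 + 1 by rewrite ltr_wpDl.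
have L0 : 0 < L by rewrite !mulr_gt0 ?exprn_gt0.
pose eps := (2 * K ^+ 4 * L * D)^-1.
have eps0 : 0 < eps by rewrite invr_gt0 !mulr_gt0 ?exprn_gt0.
have [a [N [N0 aN adec [a0 a1] aeps]]] := small_T2norm eps0.
have Daeps := le_trans (T2norm_Drearr_decreasing aN adec) aeps.
pose A1 := 2 * (K ^+ 3 * L * eps) ^+ 2; pose A2 := 2 * (K / L) ^+ 2.
have A10 : 0 <= A1 by rewrite mulr_ge0 ?sqr_ge0.
have A20 : 0 <= A2 by rewrite mulr_ge0 ?sqr_ge0.
have := cot N (fun j => a j *: vec (unit_seq j)).
have x40 (x : R) : 0 <= x ^+ 4 by rewrite exprn_even_ge0.
have mg4 j : measurable_fun setT (fun t => (g j t ^+ 4)%:E).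
  apply/measurable_EFinP; apply: measurable_funX; exact: measurable_funP.
have int_le : (\int[P]_t (`|\sum_(j < N) g j t *: (a j *: vec (unit_seq j))| ^+ 2)%:E <=
    (A1 + A2 * c4)%:E)%E.
  apply: (@le_trans _ _ (\int[P]_t (A1%:E + A2%:E * \sum_(0 <= j < N) ((sqr_seq a j)%:E * (g j t ^+ 4)%:E)))%E).
    apply: ge0_le_integral_nnsfun => t; first by rewrite lee_fin sqr_ge0.
    under [X in (_ <= _ + _ * X)%E]eq_bigr => j _ do rewrite -EFinM.
    rewrite sumEFin -EFinM -EFinD lee_fin.
    under eq_bigr => j _ do rewrite scalerA.
    exact: (multiplier_norm_le (fun j => g j t) aN Daeps (ltW eps0) L0).
  have mterm j : measurable_fun setT (fun t => ((sqr_seq a j)%:E * (g j t ^+ 4)%:E)%E).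
    by apply: emeasurable_funM; [exact: measurable_cst|exact: mg4].
  have term0 j t : (0 <= (sqr_seq a j)%:E * (g j t ^+ 4)%:E)%E.
    by rewrite -EFinM lee_fin mulr_ge0 ?sqr_seq_ge0.
  have msum : measurable_fun setT (fun t => (\sum_(0 <= j < N) ((sqr_seq a j)%:E * (g j t ^+ 4)%:E))%E).
    exact: emeasurable_sum.
  rewrite ge0_integralD//; first last.
  - by apply: emeasurable_funM; [exact: measurable_cst|exact: msum].
  - by move=> t _; rewrite mule_ge0 ?lee_fin// sume_ge0.
  rewrite integral_cst//= [P _](probability_setT P) mule1 EFinD leeD2l//.
  rewrite ge0_integralZl//; last by move=> t _; rewrite sume_ge0.
  rewrite (EFinM A2 c4); apply: lee_wpmul2l; first by rewrite lee_fin.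
  rewrite ge0_integral_sum//.
  rewrite -[leRHS]mul1e -a1 -sumEFin ge0_sume_distrl; last first.
    by move=> j _; rewrite lee_fin sqr_seq_ge0.
  apply: lee_sum => j _; rewrite ge0_integralZl ?lee_fin ?sqr_seq_ge0//.
    by rewrite lee_wpmul2l ?lee_fin ?sqr_seq_ge0// gaussian_fourth_moment.
  by move=> t _; rewrite lee_fin.
rewrite leNgt => /negP; apply.
have s0 : 0 <= A1 + A2 * c4 by rewrite addr_ge0// mulr_ge0.
apply: (@le_lt_trans _ _ (D * Num.sqrt (A1 + A2 * c4))%:E).
  apply: (@le_trans _ _ (D%:E * sqrte (\int[P]_t (`|\sum_(j < N) g j t *: (a j *: vec (unit_seq j))| ^+ 2)%:E))%E).
    apply: lee_wpmul2r; first exact: sqrte_ge0.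
    by rewrite lee_fin /D (le_trans (ler_norm B))// lerDl.
  rewrite (EFinM D) lee_wpmul2l ?lee_fin ?(ltW D0)//.
  by rewrite -[leRHS]/(sqrte (A1 + A2 * c4)%:E) lee_sqrt.
rewrite lte_fin; apply: (@lt_le_trans _ _ K^-1).
  rewrite -ltr_sqr ?nnegrE ?mulr_ge0 ?sqrtr_ge0 ?invr_ge0 ?(ltW D0) ?(ltW K0)//.
  rewrite exprMn sqr_sqrtr//.
  have -> : D ^+ 2 * (A1 + A2 * c4) = K^-1 ^+ 2 * ((1 + c4 / (c4 + 1) ^+ 2) / 2).
    by rewrite /A1 /A2 /eps /L; field; rewrite !gt_eqF.
  rewrite gtr_pMr ?exprn_gt0 ?invr_gt0// ltr_pdivrMr// mul1r.
  have : c4 / (c4 + 1) ^+ 2 < 1.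
    by rewrite ltr_pdivrMr ?exprn_gt0// mul1r; have := sqr_ge0 c4; lra.
  by lra.
rewrite -[leLHS]ger0_norm ?invr_ge0 ?(ltW K0)// -sqrtr_sqr ler_wsqrtr//.
rewrite -[leLHS]mulr1 -a1 big_mkord mulr_sumr; apply: ler_sum => j _.
rewrite normrZ exprMn real_normK ?num_real// mulrC ler_wpM2l ?sqr_ge0//.
by rewrite lerXn2r ?nnegrE ?invr_ge0 ?(ltW K0)//; exact: unit_vec_norm_ge.
Qed.

End SymmetricSpace.

Theorem proposition3p7 (R : realType) (X : completeNormedModType R)
    (coef : X -> nat -> R) (hX : is_symmetric_T2 coef) :
  [/\ ~ disjoint_upper_H coef,
      ~ upper_H X,
      ~ lower_H2 X,
      ~ weak_type2 X &
      forall (d : measure_display) (Omega : measurableType d)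
        (P : probability Omega R) (g : nat -> {RV P >-> R}),
        standard_gaussian_sequence g -> ~ cotype2 g X].
Proof.
have [_ _ _ [K K1 normK]] := hX; split.
- exact (not_disjoint_upper_H hX K1 normK).
- exact (not_upper_H hX K1 normK).
- exact (not_lower_H2 hX K1 normK).
- exact (not_weak_type2 hX K1 normK).
- exact (@not_cotype2 R X coef hX K K1 normK).
Qed.
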